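(* Let $\pi$ be a probability distribution on a Polish space $\mathcal{X}$ and $P$ a $\pi$-irreducible Markov transition kernel with $\pi P=\pi$. Suppose there exist a Borel set $J\subseteq\mathcal{X}$ with $\pi(J)>0$, a number $\beta>0$ and a probability measure $\nu$ such that $P(x,\cdot)\geq \beta\,\mathbf{1}(x\in J)\,\nu(\cdot)$ for all $x\in\mathcal{X}$. Let $(X_n,\Gamma_n)_{n\ge0}$ be the split chain described in the context, started with $X_0\sim\nu$, with regeneration times $0=T_0<T_1<T_2<\cdots$, cycle lengths $\tau_k=T_k-T_{k-1}$ and block sums $\Xi_k(g)=\sum_{i=T_{k-1}}^{T_k-1} g(X_i)$. Let $f:\mathcal{X}\to\mathbb{R}$ be Borel with $\pi(|f|)<\infty$, $\theta=\pi(f)$, $\bar f=f-\theta$. For a fixed integer $n\ge1$ let $R(n)=\min\{r: T_r\geq n\}$ and $$\hat\theta_{T_{R(n)}}=\frac{1}{T_{R(n)}}\sum_{i=0}^{T_{R(n)}-1} f(X_i).$$ If $\mathbb{E}(\Xi_1(\bar f))^2<\infty$ and $\mathbb{E}\tau_1^2<\infty$, then (i) $\mathbb{E}\,(\hat\theta_{T_{R(n)}}-\theta)^2\leq \frac{\sigma_{\rm as}^2(f)}{n^2}\,\mathbb{E}\,T_{R(n)}$, and (ii) $\mathbb{E}\,T_{R(n)}\leq n+n_0$, where $\sigma_{\rm as}^2(f)=\frac{\mathbb{E}(\Xi_1(\bar f))^2}{\mathbb{E}\tau_1}$ and $n_0=\frac{\mathbb{E}\tau_1^2}{\mathbb{E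}\tau_1}-1$.
   Context: Split chain: given $J,\beta,\nu$ as in the claim, define the residual kernel $Q(x,\cdot)=\frac{P(x,\cdot)-\beta\mathbf{1}(x\in J)\nu(\cdot)}{1-\beta\mathbf{1}(x\in J)}$. The bivariate Markov chain $(X_n,\Gamma_n)$ on $\mathcal{X}\times\{0,1\}$ is defined by: $\Gamma_{n-1}$ depends only on $X_{n-1}$ with $\Pr(\Gamma_{n-1}=1\mid X_{n-1}=x)=\beta\mathbf{1}(x\in J)$; given $\Gamma_{n-1}=1$, $X_n\sim\nu$; given $\Gamma_{n-1}=0$ and $X_{n-1}=x$, $X_n\sim Q(x,\cdot)$. Regeneration times: $T_0=0$ (since $X_0\sim\nu$), $T_1=\min\{n\ge1:\Gamma_{n-1}=1\}$, $T_k=\min\{n>T_{k-1}:\Gamma_{n-1}=1\}$. Throughout, $\Pr$ and $\mathbb{E}$ without subscript refer to the split chain started with $X_0\sim\nu$. *)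

(* Defs.v *)
From HB Require Import structures.
From mathcomp Require Import all_boot all_order all_algebra.
From mathcomp Require Import all_classical all_reals all_analysis.
Set Implicit Arguments. Unset Strict Implicit. Unset Printing Implicit Defensive.
Import Order.TTheory GRing.Theory Num.Theory.
Local Open Scope classical_set_scope.
Local Open Scope ring_scope.
Local Open Scope ereal_scope.

(** Polish space: a complete pseudometric space (the metric is given by the
    type) which is Hausdorff (so the pseudometric is a metric) and separable. *)
Definition polish_space {R : realType} (M : completePseudoMetricType R) : Prop :=
  hausdorff_space M /\ exists D : set M, countable D /\ closure D = setT.

Notation borel_type M := (g_sigma_algebraType (@open M)).

Section Defs.
Context {R : realType}.

Fixpoint kiter {d} {X : measurableType d}
    (P : X -> {measure set X -> \bar R}) (n : nat) (x : X) (A : set X) : \bar R :=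
  match n with
  | 0%N => \d_x A
  | n'.+1 => \int[P x]_y kiter P n' y A
  end.

Definition pi_irreducible {d} {X : measurableType d}
    (pi : set X -> \bar R) (P : X -> {measure set X -> \bar R}) : Prop :=
  forall A, measurable A -> 0 < pi A ->
    forall x, exists n : nat, 0 < kiter P n.+1 x A.

Definition Qres {d} {X : measurableType d}
    (P : X -> {measure set X -> \bar R}) (beta : R) (J : set X)
    (nu : set X -> \bar R) (x : X) (A : set X) : \bar R :=
  (P x A - (beta * \1_J x)%R%:E * nu A) * ((1 - beta * \1_J x)^-1)%R%:E.

Definition cyl {T : Type} {Om : Type} (X : nat -> Om -> T) (G : nat -> Om -> bool)
    (n : nat) (A : nat -> set T) (B : nat -> set bool) : set Om :=
  [set w | forall i, (i < n)%N -> A i (X i w) /\ B i (G i w)].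

(** (X_n, Gamma_n) on (Om, Pr) is the split chain started with X_0 ~ nu:
    - X_0 ~ nu;
    - given the past and X_n, Gamma_n is Bernoulli(beta 1(X_n in J));
    - given the past (including Gamma_n), X_{n+1} ~ nu if Gamma_n = 1 and
      X_{n+1} ~ Q(X_n, .) if Gamma_n = 0.
    The conditional laws are expressed on cylinder events (a pi-system
    generating the natural filtration). *)
Definition is_split_chain {d d'} {X : measurableType d} {Om : measurableType d'}
    (Pr : probability Om R) (Xs : nat -> Om -> X) (G : nat -> Om -> bool)
    (P : X -> {measure set X -> \bar R}) (beta : R) (J : set X)
    (nu : set X -> \bar R) : Prop :=
  [/\ (forall n, measurable_fun setT (Xs n)),
      (forall n, measurable [set w | G n w]),
      (forall A, measurable A -> Pr (Xs 0%N @^-1` A) = nu A),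
      (forall n A B C, (forall i, measurable (A i)) -> measurable C ->
         Pr (cyl Xs G n A B `&` [set w | C (Xs n w) /\ G n w]) =
         \int[Pr]_(w in cyl Xs G n A B `&` Xs n @^-1` C)
            (beta * \1_J (Xs n w))%R%:E) &
      (forall n A B C, (forall i, measurable (A i)) -> measurable C ->
         Pr (cyl Xs G n.+1 A B `&` Xs n.+1 @^-1` C) =
         \int[Pr]_(w in cyl Xs G n.+1 A B)
            (if G n w then nu C else Qres P beta J nu (Xs n w) C))].

Definition next_regen (g : nat -> bool) (m : nat) : option nat :=
  match pselect (exists n, (m < n)%N && g n.-1) with
  | left H => Some (ex_minn H)
  | right _ => None
  end.

Fixpoint regen (g : nat -> bool) (k : nat) : option nat :=
  match k with
  | 0%N => Some 0%N
  | k'.+1 => obind (next_regen g) (regen g k')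
  end.

Definition Tbar (g : nat -> bool) (k : nat) : \bar R :=
  if regen g k is Some t then (t%:R)%:E else +oo.

(** R(n) = min {r : T_r >= n}  (T_r = +oo counts as >= n). *)
Definition Rn (g : nat -> bool) (n : nat) : nat :=
  let p := fun r => if regen g r is Some t then (n <= t)%N else true in
  match pselect (exists r, p r) with
  | left H => ex_minn H
  | right _ => 0%N
  end.

Definition TR (g : nat -> bool) (n : nat) : option nat := regen g (Rn g n).

Definition Xi1 {T Om : Type} (h : T -> R) (Xs : nat -> Om -> T)
    (G : nat -> Om -> bool) (w : Om) : R :=
  if regen (G^~ w) 1 is Some t then (\sum_(i < t) h (Xs i w))%R else 0%R.

Definition theta_hat {T Om : Type} (f : T -> R) (Xs : nat -> Om -> T)
    (G : nat -> Om -> bool) (n : nat) (w : Om) : R :=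
  if TR (G^~ w) n is Some t then ((\sum_(i < t) f (Xs i w)) / t%:R)%R else 0%R.

End Defs.

Definition TRbar {R : realType} (g : nat -> bool) (n : nat) : \bar R :=
  if TR g n is Some t then (t%:R)%:E else +oo.

(* Main.v *)
Require Import Defs.
From HB Require Import structures.
From mathcomp Require Import all_boot all_order all_algebra.
From mathcomp Require Import all_classical all_reals all_analysis.
From mathcomp Require Import measurable_realfun ring lra.
Import Order.TTheory GRing.Theory Num.Theory.
Local Open Scope classical_set_scope.
Local Open Scope ring_scope.
Local Open Scope ereal_scope.

(** Write [N_m] for the first renewal time [>= m], so that [tau_1 = N_1] and
    [T_(R(n)) = N_n], and let [u_k] be the probability that [k] is a renewal
    time. Passing from [N_n] to [N_(n+1)] changes something only when [n] is a
    renewal time, and then a cycle independent of the past is appended. Hence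
    [E N_n = E tau * sum_(k < n) u_k], and for the sums [W_n] of [fbar] up to
    [N_n] one has [E W_n^2 <= E Xi_1^2 * sum_(k < n) u_k], the cross term
    vanishing because [E Xi_1 = 0]; (i) follows from [N_n >= n].

    [E Xi_1 (fbar) = 0] is Kac's formula: the occupation measure of a cycle is
    invariant and, once scaled by [beta pi(J)], is dominated by [pi]; the
    difference is an invariant measure that does not charge [J], hence is zero
    by irreducibility.

    For (ii), the overshoot [V_n = N_n - n] has a subadditive expectation [v_n],
    whence [(n + 1) v_n <= 2 sum_(k <= n) v_k], while the same one-step analysis
    gives [E V_n^2 - v_n + 2 sum_(k <= n) v_k
    = E (tau^2 - tau) sum_(k < n) u_k].
    Together with [v_n^2 <= E V_n^2] this is [v_n <= E tau^2 / E tau - 1]. *)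

Set Implicit Arguments.
Unset Strict Implicit.
Unset Printing Implicit Defensive.

(** * Laws of random variables on events *)

Lemma addIe {R : realDomainType} (x : \bar R) :
  x \is a fin_num -> injective (fun y => y + x).
Proof. by move=> xfin y z yz; rewrite -(addeK y xfin) yz addeK. Qed.

Lemma ge0_integral_mrestr (d : measure_display) (T : measurableType d)
    (R : realType) (m : {measure set T -> \bar R}) (D : set T)
    (mD : measurable D) (f : T -> \bar R) :
  measurable_fun setT f -> (forall x, 0 <= f x) ->
  \int[mrestr m mD]_x f x = \int[m]_(x in D) f x.
Proof.
move=> mf f0; have mCD : measurable (~` D) by exact: measurableC.
rewrite -(setUv D) ge0_integral_setU ?setUv//; last exact/disj_setPCl.
rewrite [X in _ + X](_ : _ = 0) ?adde0; last first.
  rewrite (eq_measure_integral mzero) ?integral_measure_zero//.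
  by move=> A _ AD; rewrite /= /mrestr (disjoints_subset _ _).2 ?measure0.
by apply: eq_measure_integral => A _ AD; rewrite /= /mrestr setIidl.
Qed.

Lemma ge0_integral_density (d : measure_display) (T : measurableType d)
    (R : realType) (m1 m2 : {finite_measure set T -> \bar R})
    (g f : T -> \bar R) :
  measurable_fun setT g -> (forall x, 0 <= g x) ->
  (forall A, measurable A -> m1 A = \int[m2]_(x in A) g x) ->
  measurable_fun setT f -> (forall x, 0 <= f x) ->
  \int[m1]_x f x = \int[m2]_x (f x * g x).
Proof.
move=> mg g0 m1E mf f0.
have m12 : m1 `<< m2.
  apply/null_content_dominatesP => A mA A0.
  by rewrite m1E// null_set_integral//; exact: measurable_funTS.
rewrite -(Radon_Nikodym_SigmaFinite.change_of_variables m12)//.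
have intRN := Radon_Nikodym_SigmaFinite.f_integrable m12.
have mRN := measurable_int _ intRN.
apply: ae_eq_integral => //; try exact: emeasurable_funM.
apply: ae_eqe_mul2l; apply: integral_ae_eq => // A _ mA.
by rewrite -m1E// -Radon_Nikodym_SigmaFinite.f_integral.
Qed.

Lemma integral_probability_cst (d : measure_display) (T : measurableType d)
    (R : realType) (P : probability T R) (c : R) : \int[P]_x c%:E = c%:E.
Proof. by rewrite -[RHS](expectation_cst P) unlock. Qed.

Lemma integral_sqrD_centered (d : measure_display) (T : measurableType d)
    (R : realType) (P : probability T R) (f : T -> R) (c : R) :
  P.-integrable setT (EFin \o f) -> \int[P]_x (f x)%:E = 0 ->
  \int[P]_x (f x ^+ 2)%:E < +oo ->
  \int[P]_x ((c + f x) ^+ 2)%:E = (c ^+ 2)%:E + \int[P]_x (f x ^+ 2)%:E.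
Proof.
move=> int_f f_mean0 f_sqr_lty.
have mf : measurable_fun setT f by exact/measurable_EFinP/measurable_int/int_f.
have int_sqr : P.-integrable setT (fun x => (f x ^+ 2)%:E).
  apply/integrableP; split;
    first by apply/measurable_EFinP; exact: measurable_funX.
  by under eq_integral do rewrite gee0_abs ?lee_fin ?sqr_ge0//.
have int_cst : P.-integrable setT (fun=> (c ^+ 2)%:E).
  exact: finite_measure_integrable_cst.
have int_lin : P.-integrable setT (fun x => (2 * c)%:E * (f x)%:E).
  exact: integrableZl.
under eq_integral => x _.
  rewrite (_ : ((c + f x) ^+ 2)%:E =
    ((c ^+ 2)%:E + (2 * c)%:E * (f x)%:E) + (f x ^+ 2)%:E); last first.
    by rewrite -EFinM -!EFinD; congr EFin; ring.
  over.
rewrite integralD//; last exact: integrableD.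
by rewrite integralD// integralZl// f_mean0 mule0 adde0
  integral_probability_cst.
Qed.

Section event_law.
Context {d d' : measure_display} {T : measurableType d} {Y : measurableType d'}
  {R : realType}.

Definition event_law (m : set T -> \bar R) (D : set T) (mD : measurable D)
    (phi : T -> Y) (mphi : measurable_fun setT phi) : set Y -> \bar R :=
  pushforward (mrestr m mD) phi.

HB.instance Definition _ (m : {measure set T -> \bar R}) (D : set T)
    (mD : measurable D) (phi : T -> Y) (mphi : measurable_fun setT phi) :=
  Measure.copy (event_law m mD mphi)
    (measure_function_pushforward__canonical__measure_function_Measure
      (mrestr m mD) mphi).

Lemma event_lawE (m : {measure set T -> \bar R}) (D : set T) (mD : measurable D)
    (phi : T -> Y) (mphi : measurable_fun setT phi) (A : set Y) :
  event_law m mD mphi A = m (D `&` phi @^-1` A).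
Proof. by rewrite setIC. Qed.

Lemma ge0_integral_event_law (m : {measure set T -> \bar R}) (D : set T)
    (mD : measurable D) (phi : T -> Y) (mphi : measurable_fun setT phi)
    (f : Y -> \bar R) :
  measurable_fun setT f -> (forall y, 0 <= f y) ->
  \int[event_law m mD mphi]_y f y = \int[m]_(x in D) f (phi x).
Proof.
move=> mf f0; rewrite ge0_integral_pushforward// preimage_setT.
by rewrite ge0_integral_mrestr//=; exact: measurableT_comp.
Qed.

Let event_law_fin (m : {finite_measure set T -> \bar R}) (D : set T)
    (mD : measurable D) (phi : T -> Y) (mphi : measurable_fun setT phi) :
  fin_num_fun (event_law m mD mphi).
Proof.
move=> A mA; rewrite event_lawE; apply: fin_num_measure.
by apply: measurableI => //; rewrite -[X in measurable X]setTI; exact: mphi.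
Qed.

HB.instance Definition _ (m : {finite_measure set T -> \bar R}) (D : set T)
    (mD : measurable D) (phi : T -> Y) (mphi : measurable_fun setT phi) :=
  Measure_isFinite.Build _ _ _ (event_law m mD mphi) (event_law_fin m mD mphi).

Lemma ge0_integral_eq_event_law (m : {measure set T -> \bar R})
    (D1 D2 : set T) (phi1 phi2 : T -> Y) (c : R) (f : Y -> \bar R) :
  measurable D1 -> measurable D2 ->
  measurable_fun setT phi1 -> measurable_fun setT phi2 -> (0 <= c)%R ->
  (forall A, measurable A ->
    m (D1 `&` phi1 @^-1` A) = c%:E * m (D2 `&` phi2 @^-1` A)) ->
  measurable_fun setT f -> (forall y, 0 <= f y) ->
  \int[m]_(x in D1) f (phi1 x) = c%:E * \int[m]_(x in D2) f (phi2 x).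
Proof.
move=> mD1 mD2 mphi1 mphi2 c0 law12 mf f0.
rewrite -(ge0_integral_event_law m mD1 mphi1)//.
rewrite -(ge0_integral_event_law m mD2 mphi2)//.
rewrite -[c]/((NngNum c0)%:num) -ge0_integral_mscale//.
apply: eq_measure_integral => A mA _.
by rewrite [LHS]event_lawE law12// -event_lawE.
Qed.

Lemma ge0_integral_event_law_density (m : {finite_measure set T -> \bar R})
    (D1 D2 : set T) (phi : T -> Y) (g f : Y -> \bar R) :
  measurable D1 -> measurable D2 -> measurable_fun setT phi ->
  measurable_fun setT g -> (forall y, 0 <= g y) ->
  (forall A, measurable A ->
    m (D1 `&` phi @^-1` A) = \int[m]_(x in D2 `&` phi @^-1` A) g (phi x)) ->
  measurable_fun setT f -> (forall y, 0 <= f y) ->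
  \int[m]_(x in D1) f (phi x) = \int[m]_(x in D2) (f (phi x) * g (phi x)).
Proof.
move=> mD1 mD2 mphi mg g0 law12 mf f0.
rewrite -(ge0_integral_event_law m mD1 mphi)//.
rewrite -(ge0_integral_event_law m mD2 mphi (f := fun y => f y * g y));
  last 2 first.
- exact: emeasurable_funM.
- by move=> y; exact: mule_ge0.
apply: ge0_integral_density => // A mA.
transitivity (m (D1 `&` phi @^-1` A)); first exact: event_lawE.
rewrite law12// integral_mkcondr [RHS]integral_mkcond.
rewrite ge0_integral_event_law//.
- by apply/(measurable_restrictT _ mA); exact: measurable_funTS.
- by move=> y; exact: erestrict_ge0.
Qed.

Lemma event_law_scale_gen (G : set (set Y))
    (m : {finite_measure set T -> \bar R})
    (m' : {finite_measure set Y -> \bar R}) (D : set T) (phi : T -> Y) (c : R) :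
  (measurable : set (set Y)) = <<s G >> -> setI_closed G -> G setT ->
  measurable D -> measurable_fun setT phi -> (0 <= c)%R ->
  (forall A, G A -> m (D `&` phi @^-1` A) = c%:E * m' A) ->
  forall A, measurable A -> m (D `&` phi @^-1` A) = c%:E * m' A.
Proof.
move=> genG GI GT mD mphi c0 scaleG A mA.
transitivity (event_law m mD mphi A); first exact/esym/event_lawE.
apply: (measure_unique G (fun=> setT) genG GI _ _
  (event_law m mD mphi) (mscale (NngNum c0) m')) => //.
- by rewrite bigcup_const.
- by move=> B GB; apply: (eq_trans _ (scaleG B GB)); exact: event_lawE.
- by move=> _; rewrite -ge0_fin_numE// fin_num_measure.
Qed.

End event_law.

Lemma event_indep_gen {d d1 d2 : measure_display} {T : measurableType d}
    {Y1 : measurableType d1} {Y2 : measurableType d2} {R : realType}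
    (G1 : set (set Y1)) (G2 : set (set Y2))
    (m : {finite_measure set T -> \bar R})
    (m' : {finite_measure set Y2 -> \bar R}) (D : set T)
    (f1 : T -> Y1) (f2 : T -> Y2) :
  (measurable : set (set Y1)) = <<s G1 >> -> setI_closed G1 -> G1 setT ->
  (measurable : set (set Y2)) = <<s G2 >> -> setI_closed G2 -> G2 setT ->
  measurable D -> measurable_fun setT f1 -> measurable_fun setT f2 ->
  (forall A B, G1 A -> G2 B ->
    m (D `&` f1 @^-1` A `&` f2 @^-1` B) = m (D `&` f1 @^-1` A) * m' B) ->
  forall A B, measurable A -> measurable B ->
    m (D `&` f1 @^-1` A `&` f2 @^-1` B) = m (D `&` f1 @^-1` A) * m' B.
Proof.
move=> genG1 G1I G1T genG2 G2I G2T mD mf1 mf2 indep.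
have mDf1 A : measurable A -> measurable (D `&` f1 @^-1` A).
  by move=> mA; apply: measurableI => //; rewrite -[X in measurable X]setTI;
    exact: mf1.
have mDf2 B : measurable B -> measurable (D `&` f2 @^-1` B).
  by move=> mB; apply: measurableI => //; rewrite -[X in measurable X]setTI;
    exact: mf2.
have indepG1 A B : G1 A -> measurable B ->
    m (D `&` f1 @^-1` A `&` f2 @^-1` B) = m (D `&` f1 @^-1` A) * m' B.
  move=> G1A mB; have mA : measurable (D `&` f1 @^-1` A).
    by apply: mDf1; rewrite genG1; exact: sub_sigma_algebra.
  rewrite -[m (D `&` _)]fineK ?fin_num_measure//.
  apply: (event_law_scale_gen genG2) => // [|C G2C]; first exact: fine_ge0.
  by rewrite fineK ?fin_num_measure// indep.
move=> A B mA mB; rewrite setIAC muleC -[m' B]fineK ?fin_num_measure//.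
transitivity ((fine (m' B))%:E * event_law m mD mf1 A);
  last by congr (_ * _); exact: event_lawE.
apply: (event_law_scale_gen genG1) => //; [exact: mDf2|exact: fine_ge0|].
move=> C G1C; rewrite fineK ?fin_num_measure// setIAC indepG1// muleC.
by congr (_ * _); exact/esym/event_lawE.
Qed.

(** * Path space *)

Definition cylinder {T : Type} (n : nat) (A : nat -> set T)
    (B : nat -> set bool)
    : set (nat -> T * bool) :=
  [set p | forall i, (i < n)%N -> A i (p i).1 /\ B i (p i).2].

Definition splice {S : Type} (n : nat) (a b : nat -> S) : nat -> S :=
  fun i => if (i < n)%N then a i else b (i - n)%N.

Definition shift_seq {S : Type} (n : nat) (p : nat -> S) : nat -> S :=
  fun i => p (n + i)%N.

Definition marks {T : Type} (p : nat -> T * bool) : nat -> bool :=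
  fun i => (p i).2.

Lemma splice_addn {S : Type} n m (a b : nat -> S) :
  splice n a b (n + m)%N = b m.
Proof. by rewrite /splice ltnNge leq_addr addKn. Qed.

Section cylinder_theory.
Context {T : Type}.
Implicit Types (A : nat -> set T) (B : nat -> set bool).

Lemma cylinder_setT n : cylinder n (fun=> [set: T]) (fun=> setT) = setT.
Proof. by apply/seteqP; split. Qed.

Lemma cylinder0 A B : cylinder 0 A B = setT.
Proof. by apply/seteqP; split. Qed.

Lemma cylinderS n A B :
  cylinder n.+1 A B = cylinder n A B `&` [set p | A n (p n).1 /\ B n (p n).2].
Proof.
apply/seteqP; split=> p /=.
  by move=> pAB; split=> [i ni|]; apply: pAB => //; exact: ltnW.
by move=> [pAB pn] i; rewrite ltnS leq_eqVlt => /predU1P[->//|/pAB].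
Qed.

Lemma setI_cylinder n A B A' B' :
  cylinder n A B `&` cylinder n A' B' =
  cylinder n (fun i => A i `&` A' i) (fun i => B i `&` B' i).
Proof.
apply/seteqP; split=> p /=.
  by move=> [pAB pAB'] i ni; have [? ?] := pAB i ni; have [? ?] := pAB' i ni.
by move=> pI; split=> i /pI[[? ?] [? ?]].
Qed.

Lemma cylinder_splice n m A B A' B' :
  cylinder (n + m) (splice n A A') (splice n B B') =
  cylinder n A B `&` shift_seq n @^-1` cylinder m A' B'.
Proof.
apply/seteqP; split=> p /=.
  move=> pAB; rewrite /splice in pAB; split=> i ilt.
    by have := pAB i; rewrite ilt; apply; exact: ltn_addr.
  by have := pAB (n + i)%N;
    rewrite ltn_add2l addKn [(_ < n)%N]ltnNge leq_addr => /(_ ilt).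
move=> [pAB pAB'] i inm; rewrite /splice; case: ltnP => ni; first exact: pAB.
by have := pAB' (i - n)%N; rewrite /shift_seq subnKC//; apply;
  rewrite ltn_subLR.
Qed.

Lemma cylinder_widen n m A B : (n <= m)%N ->
  cylinder n A B =
  cylinder m (splice n A (fun=> setT)) (splice n B (fun=> setT)).
Proof.
by move=> nm; rewrite -(subnKC nm) cylinder_splice cylinder_setT setIT.
Qed.

End cylinder_theory.

Definition cylinders {d : measure_display} (T : measurableType d) (N : set nat)
    : set (set (nat -> T * bool)) :=
  [set C | exists n A B,
    [/\ N n, (forall i, measurable (A i)) & C = cylinder n A B]].
Arguments cylinders {d} T N _ : assert.

(** The same carrier is given the sigma-algebra of the whole path
    ([path_space]) or of its first [n] coordinates ([past_space]). *)
Definition cyl_space {d : measure_display} (T : measurableType d)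
    (N : set nat) :=
  g_sigma_algebraType (cylinders T N).

HB.instance Definition _ d (T : measurableType d) N :=
  Measurable.on (cyl_space T N).

Notation path_space T := (cyl_space T setT).
Notation past_space T n := (cyl_space T [set n]).

Section path_space.
Context {d : measure_display} (T : measurableType d).

Lemma measurable_splice (n : nat) (A A' : nat -> set T) :
  (forall i, measurable (A i)) -> (forall i, measurable (A' i)) ->
  forall i, measurable (splice n A A' i).
Proof. by move=> mA mA' i; rewrite /splice; case: ifP. Qed.

Lemma setI_closed_cylinders (N : set nat) :
  (forall m n, N m -> N n -> N (maxn m n)) -> setI_closed (cylinders T N).
Proof.
move=> N_maxn _ _ [n1 [A1 [B1 [N1 mA1 ->]]]] [n2 [A2 [B2 [N2 mA2 ->]]]].
rewrite (cylinder_widen _ _ (leq_maxl n1 n2))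
  (cylinder_widen A2 _ (leq_maxr n1 n2)).
rewrite setI_cylinder; do 3 eexists; split; last reflexivity;
  first exact: N_maxn.
by move=> i; apply: measurableI; exact: measurable_splice.
Qed.

Lemma cylindersT (N : set nat) n : N n -> cylinders T N setT.
Proof.
by move=> Nn; exists n, (fun=> setT), (fun=> setT); rewrite cylinder_setT.
Qed.

Lemma measurable_cylinder n A B : (forall i, measurable (A i)) ->
  measurable (cylinder n A B : set (path_space T)).
Proof. by move=> mA; apply: sub_sigma_algebra; exists n, A, B. Qed.

Section coordinates.
Variables (N : set nat) (n i : nat).
Hypotheses (Nn : N n) (lt_in : (i < n)%N).

Let measurable_coord (A : set T) (B : set bool) : measurable A ->
  measurable ([set p | A (p i).1 /\ B (p i).2] : set (cyl_space T N)).
Proof.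
move=> mA; apply: sub_sigma_algebra;
  exists n, (fun j => if j == i then A else setT),
  (fun j => if j == i then B else setT); split => //;
    first by move=> j; case: ifP.
apply/seteqP; split=> p /= => [[pA pB] j _|/(_ i lt_in)]; last by rewrite eqxx.
by case: eqP => [->|].
Qed.

Lemma measurable_state : measurable_fun setT (fun p : cyl_space T N => (p i).1).
Proof.
move=> _ A mA; rewrite setTI; have := measurable_coord setT mA.
by congr (measurable _); apply/seteqP; split=> p //= [].
Qed.

Lemma measurable_mark :
  measurable_fun setT (fun p : cyl_space T N => marks p i).
Proof.
move=> _ B mB; rewrite setTI; have := measurable_coord B measurableT.
by congr (measurable _); apply/seteqP; split=> p //= [].
Qed.

End coordinates.

Lemma measurable_path_state i :
  measurable_fun setT (fun p : path_space T => (p i).1).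
Proof. exact: (@measurable_state _ i.+1). Qed.

Lemma measurable_path_mark i :
  measurable_fun setT (fun p : path_space T => marks p i).
Proof. exact: (@measurable_mark _ i.+1). Qed.

Lemma measurable_fun_path d' (S : measurableType d') (N : set nat)
    (f : S -> cyl_space T N) :
  (forall i, measurable_fun setT (fun x => (f x i).1)) ->
  (forall i, measurable_fun setT (fun x => (f x i).2)) ->
  measurable_fun setT f.
Proof.
move=> mf1 mf2.
apply: (@measurability _ _ S (cyl_space T N) setT f (cylinders T N)) => //.
move=> _ [_ [n [A [B [_ mA ->]]]] <-]; rewrite setTI.
rewrite (_ : _ @^-1` _ = \bigcap_(i in `I_n)
   ((fun x => (f x i).1) @^-1` A i `&` (fun x => (f x i).2) @^-1` B i));
  last first.
  by apply/seteqP; split=> x.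
apply: bigcap_measurableType => i _.
by apply: measurableI; rewrite -[X in measurable X]setTI;
  [exact: mf1|exact: mf2].
Qed.

Lemma measurable_shift n :
  measurable_fun setT (shift_seq n : path_space T -> path_space T).
Proof.
apply: measurable_fun_path => i; first exact: measurable_path_state.
exact: measurable_path_mark.
Qed.

Lemma measurable_past n :
  measurable_fun setT (id : path_space T -> past_space T n).
Proof.
apply: measurable_fun_path => i; first exact: measurable_path_state.
exact: measurable_path_mark.
Qed.

Lemma past_measurable n (D : set (past_space T n)) : measurable D ->
  measurable (D : set (path_space T)).
Proof.
by move=> mD; have := @measurable_past n measurableT _ mD; rewrite setTI.
Qed.

End path_space.
Arguments measurable_shift {d T} n.
Arguments measurable_past {d T} n.

(** * Renewal times *)

Definition renewal (g : nat -> bool) (s : nat) : bool := (s == 0%N) || g s.-1.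

Definition first_renewal (g : nat -> bool) (m : nat) : option nat :=
  if m is k.+1 then next_regen g k else Some 0%N.
Arguments first_renewal : simpl never.

Section first_renewal.
Implicit Types (g : nat -> bool) (m n s : nat).

Lemma first_renewal_Some g m s : first_renewal g m = Some s <->
  [/\ (m <= s)%N, renewal g s & forall j, (m <= j < s)%N -> ~~ renewal g j].
Proof.
rewrite /first_renewal; case: m => [|m].
  split=> [[<-]|]; first by split.
  by case: s => [//|s [_ _ /(_ 0%N isT)]].
have renewalE j : (m < j)%N -> renewal g j = g j.-1 by case: j.
rewrite /next_regen; case: pselect => [ex|nex]; last first.
  by split=> // -[ms rs _]; case: nex; exists s; rewrite ms -renewalE.
case: ex_minnP => r /andP[mr gr] rmin; split=> [[<-]|[ms rs smin]].
  split; rewrite ?renewalE// => j /andP[mj jr].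
  by apply: contraL jr => rj; rewrite -leqNgt rmin// mj -renewalE.
congr Some; apply/eqP; rewrite eqn_leq rmin ?ms -?renewalE//=.
by rewrite leqNgt; apply: contraL gr => rs'; rewrite -renewalE// smin// mr.
Qed.

Lemma first_renewal_None g m : first_renewal g m = None <->
  forall s, (m <= s)%N -> ~~ renewal g s.
Proof.
split=> [mN s ms|noren].
  apply/negP => rs.
  have ex : exists s, (m <= s)%N && renewal g s by exists s; rewrite ms.
  case: (ex_minnP ex) => r /andP[mr rr] rmin.
  have : first_renewal g m = Some r; last by rewrite mN.
  apply/first_renewal_Some; split=> // j /andP[mj jr].
  by apply: contraL jr => rj; rewrite -leqNgt rmin// mj.
case mE : (first_renewal g m) => [s|//].
by move/first_renewal_Some : mE => [ms rs _]; have := noren _ ms; rewrite rs.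
Qed.

Lemma first_renewal_congr g g' m m' k :
  (forall s,
    (m' <= s)%N && renewal g' s = (m <= k + s)%N && renewal g (k + s)) ->
  (forall s, (m <= s)%N -> renewal g s -> (k <= s)%N) ->
  first_renewal g m = omap (addn k) (first_renewal g' m').
Proof.
move=> mm' mk; case gE : (first_renewal g' m') => [s|] /=; last first.
  apply/first_renewal_None => s ms; apply/negP => rs.
  have ks := mk s ms rs; have := mm' (s - k)%N; rewrite subnKC// ms rs.
  by move=> /andP[m's]; exact/negP/((first_renewal_None _ _).1 gE).
move/first_renewal_Some : gE => [m's rs smin]; apply/first_renewal_Some.
have := mm' s; rewrite m's rs => /esym/andP[-> ->]; split=> // j /andP[mj js].
apply/negP => rj; have kj := mk j mj rj.
have := mm' (j - k)%N; rewrite subnKC// mj rj => /andP[m'j].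
by apply/negP/smin; rewrite m'j ltn_subLR.
Qed.

Lemma first_renewal_le g m s : renewal g s -> (m <= s)%N ->
  exists2 r, first_renewal g m = Some r & (r <= s)%N.
Proof.
move=> rs ms; case mE : (first_renewal g m) => [r|]; last first.
  by move/first_renewal_None : mE => /(_ _ ms); rewrite rs.
exists r => //; move/first_renewal_Some : mE => [mr _ rmin].
by rewrite leqNgt; apply: contraL rs => sr; rewrite rmin// ms.
Qed.

Lemma renewal_shift g n r :
  renewal g n -> renewal (shift_seq n g) r = renewal g (n + r).
Proof. by case: r => [|r] rn; rewrite ?addn0// /renewal /shift_seq addnS. Qed.

Lemma first_renewal_id g n : renewal g n -> first_renewal g n = Some n.
Proof.
move=> rn; apply/first_renewal_Some; split=> // j /andP[nj].
by rewrite ltnNge nj.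
Qed.

Lemma first_renewalS g n : ~~ renewal g n ->
  first_renewal g n.+1 = first_renewal g n.
Proof.
move=> rn; rewrite (@first_renewal_congr g g n.+1 n 0)//;
  first by case: first_renewal.
move=> s; rewrite add0n leq_eqVlt.
by case: eqP => [<-|//]; rewrite ltnn (negbTE rn).
Qed.

Lemma first_renewal_shift g n m : renewal g n ->
  first_renewal g (n + m) = omap (addn n) (first_renewal (shift_seq n g) m).
Proof.
move=> rn; apply: first_renewal_congr => s;
  first by rewrite leq_add2l renewal_shift.
by move=> nms _; exact: leq_trans (leq_addr _ _) nms.
Qed.

Lemma first_renewal_widen g m s n : first_renewal g m = Some s ->
  (m <= n <= s)%N -> first_renewal g n = Some s.
Proof.
move=> /first_renewal_Some[_ rs smin] /andP[mn ns]; apply/first_renewal_Some.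
by split=> // j /andP[nj js]; apply: smin; rewrite js (leq_trans mn).
Qed.

Lemma regen_ge g r t : regen g r = Some t -> (r <= t)%N.
Proof.
elim: r t => [//|r IH] t /=; case rE : (regen g r) => [s|//] st.
have /first_renewal_Some[lt_st _ _] : first_renewal g s.+1 = Some t by [].
exact: leq_ltn_trans (IH _ rE) lt_st.
Qed.

Lemma TR_first_renewal g n : (0 < n)%N -> TR g n = first_renewal g n.
Proof.
move=> n0; rewrite /TR /Rn; case: pselect => [ex|nex]; last first.
  exfalso; apply: nex; exists n; case nE : (regen g n) => [t|//].
  exact: regen_ge nE.
case: ex_minnP => -[|r]; first by rewrite /= leqNgt n0.
move=> nS rmin.
have [t rE tn] : exists2 t, regen g r = Some t & (t < n)%N.
  have := rmin r; case: (regen g r) => [t|/(_ isT)]; last by rewrite ltnn.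
  by move=> tmin; exists t => //; rewrite ltnNge; apply/negP => /tmin;
    rewrite ltnn.
have rSE : regen g r.+1 = first_renewal g t.+1 by rewrite /= rE.
rewrite rSE in nS *; case tE : (first_renewal g t.+1) => [s|]; symmetry.
  by apply: (first_renewal_widen tE); rewrite tn; rewrite tE in nS.
apply/first_renewal_None => s ns; apply: ((first_renewal_None _ _).1 tE).
exact: leq_trans tn ns.
Qed.

End first_renewal.

Section renewal_time.
Context {R : realType}.
Implicit Types (g : nat -> bool) (m n : nat).

Definition renewal_time g m : \bar R :=
  if first_renewal g m is Some s then (s%:R)%:E else +oo.

Definition overshoot g m : \bar R :=
  if first_renewal g m is Some s then ((s - m)%N%:R)%:E else +oo.

Lemma TRbar_renewal_time g n : (0 < n)%N -> TRbar g n = renewal_time g n.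
Proof. by move=> n0; rewrite /TRbar TR_first_renewal. Qed.

Lemma renewal_time_ge0 g m : 0 <= renewal_time g m.
Proof.
by rewrite /renewal_time; case: first_renewal => [s|//]; rewrite lee_fin.
Qed.

Lemma overshoot_ge0 g m : 0 <= overshoot g m.
Proof.
by rewrite /overshoot; case: first_renewal => [s|//]; rewrite lee_fin.
Qed.

Lemma overshoot0 g : overshoot g 0 = 0.
Proof. by []. Qed.

Lemma renewal_timeE g m : renewal_time g m = (m%:R)%:E + overshoot g m.
Proof.
rewrite /renewal_time /overshoot; case mE : first_renewal => [s|//].
by move/first_renewal_Some : mE => [ms _ _]; rewrite -EFinD -natrD subnKC.
Qed.

Lemma renewal_time_ge g m : (m%:R)%:E <= renewal_time g m.
Proof. by rewrite renewal_timeE leeDl// overshoot_ge0. Qed.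

Lemma renewal_timeS g n :
  renewal_time g n.+1 =
  renewal_time g n +
    (if renewal g n then renewal_time (shift_seq n g) 1 else 0).
Proof.
case: ifPn => rn; last by rewrite adde0 /renewal_time first_renewalS.
rewrite /renewal_time (first_renewal_id rn) -addn1 first_renewal_shift//.
by case: first_renewal => [s|//] /=; rewrite -EFinD -natrD.
Qed.

(** Stated without subtraction, so that it holds in [\bar R] even when the next
    renewal time is infinite. *)
Lemma overshoot_sqrS g n :
  overshoot g n.+1 ^+ 2 + overshoot g n.+1 + overshoot g n +
    (if renewal g n then renewal_time (shift_seq n g) 1 else 0) =
  overshoot g n ^+ 2 +
    (if renewal g n then renewal_time (shift_seq n g) 1 ^+ 2 else 0).
Proof.
case: ifPn => rn.
  rewrite /overshoot (first_renewal_id rn) -addn1 first_renewal_shift//.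
  rewrite /renewal_time; case sE : (first_renewal (shift_seq n g) 1) => [[|s]|].
  - by move/first_renewal_Some : sE => [].
  - rewrite [omap _ _]/= addnS addn1 subnn subSS addKn.
    by rewrite -!EFin_expe -!EFinD; congr EFin; rewrite -natr1; ring.
  - by rewrite [omap _ _]/= subnn !expe2 mul0e add0e mulyy.
rewrite /overshoot first_renewalS//; case sE : first_renewal => [s|//].
move/first_renewal_Some : sE => [ns rs _].
have {}ns : (n < s)%N.
  by move: ns; rewrite leq_eqVlt => /predU1P[nE|//]; rewrite nE rs in rn.
rewrite !adde0 -!EFin_expe -!EFinD; congr EFin.
by rewrite -(subnSK ns) -natr1; ring.
Qed.

Lemma overshoot_sqr_ge g n (v : R) :
  (2 * v)%:E * overshoot g n <= overshoot g n ^+ 2 + (v ^+ 2)%:E.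
Proof.
rewrite /overshoot; case: first_renewal => [s|].
  rewrite -EFin_expe -EFinM -EFinD lee_fin.
  by have := sqr_ge0 ((s - n)%N%:R - v)%R; lra.
by rewrite expe2 mulyy addye// leey.
Qed.

(** The renewal after [n + m] comes no later than the one obtained by restarting
    the clock at the renewal after [n]. *)
Lemma renewal_timeD g n m : renewal_time g (n + m) <= renewal_time g n +
  \sum_(k < m) (if first_renewal g n == Some (n + k)%N
                then renewal_time (shift_seq (n + k) g) m else 0).
Proof.
have terms_ge0 (k : 'I_m) : true -> 0 <= (if first_renewal g n == Some (n + k)%N
    then renewal_time (shift_seq (n + k) g) m else 0).
  by case: ifP => // _; rewrite renewal_time_ge0.
rewrite [X in _ <= X + _]/renewal_time; case nE : (first_renewal g n) => [s|];
  last first.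
  by rewrite addye ?leey// big1.
have [ns rs _] := (first_renewal_Some _ _ _).1 nE; rewrite nE in terms_ge0.
have [nms|snm] := leqP (n + m) s.
  by rewrite {1}/renewal_time (first_renewal_widen nE) ?leq_addr// leeDl//
    sume_ge0.
have km : (s - n < m)%N by rewrite ltn_subLR.
rewrite (bigD1 (Ordinal km))//= subnKC// eqxx addeA.
apply: (@le_trans _ _ ((s%:R)%:E + renewal_time (shift_seq s g) m)); last first.
  by rewrite leeDl// sume_ge0// => k _; exact: terms_ge0.
rewrite [X in _ <= _ + X]/renewal_time.
case sE : (first_renewal (shift_seq s g) m) => [r|];
  last by rewrite addey// leey.
have [mr rr _] := (first_renewal_Some _ _ _).1 sE.
have rsr : renewal g (s + r) by rewrite -renewal_shift.
have [t tE tsr] := first_renewal_le rsr (leq_add ns mr).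
by rewrite /renewal_time tE -EFinD lee_fin -natrD ler_nat.
Qed.

End renewal_time.

Definition renewal_event {T : Type} (n : nat) : set (nat -> T * bool) :=
  [set p | renewal (marks p) n].

Definition first_renewal_event {T : Type} (m n : nat) : set (nat -> T * bool) :=
  [set p | first_renewal (marks p) m == Some n].

Section measurable_renewal.
Context {d : measure_display} {T : measurableType d}.

Lemma measurable_renewal_event (N : set nat) m n : N m -> (n <= m)%N ->
  measurable (renewal_event n : set (cyl_space T N)).
Proof.
move=> Nm; case: n => [|n] nm;
  first by rewrite (_ : renewal_event 0 = setT)// -subTset.
rewrite (_ : renewal_event n.+1 =
    setT `&` (fun p => marks p n) @^-1` [set true]).
  exact: (measurable_mark Nm).
by rewrite setTI; apply/seteqP; split.
Qed.

Lemma measurable_past_renewal_event n :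
  measurable (renewal_event n : set (past_space T n)).
Proof. exact: (@measurable_renewal_event _ n). Qed.

Lemma measurable_path_renewal_event n :
  measurable (renewal_event n : set (path_space T)).
Proof. exact: (@measurable_renewal_event _ n). Qed.

Lemma measurable_first_renewal_event (N : set nat) m n : N n ->
  measurable (first_renewal_event m n : set (cyl_space T N)).
Proof.
move=> Nn; have mrenewal j : (j <= n)%N ->
    measurable (renewal_event j : set (cyl_space T N)).
  exact: measurable_renewal_event Nn.
have [mn|nm] := leqP m n; last first.
  rewrite (_ : first_renewal_event m n = set0)//; apply/seteqP; split=> p //=.
  by move=> /eqP/first_renewal_Some[]; rewrite leqNgt nm.
rewrite (_ : first_renewal_event m n = renewal_event n `&`
    \bigcap_(j in [set j | (m <= j < n)%N]) ~` renewal_event j).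
  apply: measurableI; first exact: mrenewal.
  apply: bigcap_measurableType => j /andP[_ jn]; apply: measurableC.
  by apply: mrenewal; exact: ltnW.
apply/seteqP; split=> p /=.
  by move=> /eqP/first_renewal_Some[_ rn nmin]; split=> // j /nmin /negP.
by move=> [rn nmin]; apply/eqP/first_renewal_Some; split=> // j /nmin /negP.
Qed.

End measurable_renewal.
Arguments measurable_past_renewal_event {d T} n.
Arguments measurable_path_renewal_event {d T} n.

Section measurable_option.
Context {d d' : measure_display} {S : measurableType d} {Y : measurableType d'}.
Variable o : S -> option nat.
Hypothesis measurable_fiber : forall s, measurable [set x | o x == Some s].

Lemma measurable_option_None : measurable [set x | o x = None].
Proof.
rewrite (_ : [set _ | _] = ~` \bigcup_s [set x | o x == Some s]).
  by apply: measurableC; exact: bigcup_measurable.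
apply/seteqP; split=> x /=; first by move=> oN [s _] /=; rewrite oN.
by case oE : (o x) => [s|//] []; exists s => //=; rewrite oE.
Qed.

Lemma measurable_fun_option (F : option nat -> S -> Y) :
  (forall i, measurable_fun setT (F i)) ->
  measurable_fun setT (fun x => F (o x) x).
Proof.
move=> mF _ A mA; rewrite setTI.
have mFA i : measurable (F i @^-1` A).
  by rewrite -[X in measurable X]setTI; exact: mF.
rewrite (_ : _ @^-1` _ = ([set x | o x = None] `&` F None @^-1` A) `|`
    \bigcup_s ([set x | o x == Some s] `&` F (Some s) @^-1` A)).
  apply: measurableU;
    first by apply: measurableI => //; exact: measurable_option_None.
  by apply: bigcup_measurable => s _; exact: measurableI.
apply/seteqP; split=> x /=.
  by case oE : (o x) => [s|] Fx; [right; exists s => //=; rewrite oE|left].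
by move=> [[-> //]|[s _ [/eqP -> //]]].
Qed.

End measurable_option.

Lemma emeasurable_funX (d : measure_display) (S : measurableType d)
    (R : realType)
    (D : set S) (f : S -> \bar R) (n : nat) :
  measurable_fun D f -> measurable_fun D (fun x => f x ^+ n).
Proof.
move=> mf; elim: n => [|n IH]; first exact: measurable_cst.
by under eq_fun do rewrite expeS; exact: emeasurable_funM.
Qed.

Section measurable_renewal_time.
Context {d : measure_display} {T : measurableType d} {R : realType}.

Let mfirst m n : measurable (first_renewal_event m n : set (path_space T)).
Proof. exact: measurable_first_renewal_event. Qed.

Lemma measurable_no_renewal m :
  measurable ([set p | first_renewal (marks p) m = None] : set (path_space T)).
Proof. exact: (measurable_option_None (mfirst m)). Qed.

Lemma measurable_renewal_time m :
  measurable_fun setT (fun p : path_space T => @renewal_time R (marks p) m).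
Proof.
exact: (measurable_fun_option (mfirst m)
  (F := fun o _ => if o is Some s then (s%:R)%:E else +oo)).
Qed.

Lemma measurable_overshoot m :
  measurable_fun setT (fun p : path_space T => @overshoot R (marks p) m).
Proof.
exact: (measurable_fun_option (mfirst m)
  (F := fun o _ => if o is Some s then ((s - m)%N%:R)%:E else +oo)).
Qed.

End measurable_renewal_time.

(** * Regenerative processes *)

Definition regenerative {d : measure_display} {T : measurableType d}
    {R : realType} (mu : set (path_space T) -> \bar R) : Prop :=
  forall n (D : set (past_space T n)) (H : set (path_space T)),
    measurable D -> D `<=` renewal_event n -> measurable H ->
    mu (D `&` shift_seq n @^-1` H) = mu D * mu H.

Section subadditive_overshoot.
Context {R : realType}.
Implicit Types (v w u : nat -> R) (n k : nat).

Lemma subadditive_le_mean v n : (forall j k, v (j + k)%N <= v j + v k)%R ->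
  (n.+1%:R * v n <= 2 * \sum_(i < n.+1) v i)%R.
Proof.
move=> vD.
rewrite !mulr_natl mulr2n [X in (_ <= X + _)%R](reindex_inj rev_ord_inj)/=.
rewrite -big_split/= -[X in (_ *+ X)%R]card_ord -sumr_const.
apply: ler_sum => i _; rewrite subSS addrC.
by rewrite -[in leLHS](subnKC (ltn_ord i : i <= n)%N) vD.
Qed.

(** Here [v k] and [w k] stand for the first two moments of the overshoot at
    [k], [u k] for the renewal probability, [m1] and [m2] for the first two
    moments of a cycle length. *)
Lemma overshoot_moments_bound v w u (m1 m2 : R) n :
  (0 < m1)%R -> (0 < n)%N -> v 0%N = 0%R -> w 0%N = 0%R -> (0 <= v n)%R ->
  (n%:R + v n = m1 * \sum_(i < n) u i)%R ->
  (forall k, w k.+1 + v k.+1 + v k + u k * m1 = w k + u k * m2)%R ->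
  (forall j k, v (j + k)%N <= v j + v k)%R ->
  (v n ^+ 2 <= w n)%R ->
  (v n <= m2 / m1 - 1)%R.
Proof.
move=> m1_gt0 n_gt0 v0 w0 vn_ge0 renewal_eq overshoot_eq vD jensen.
have telescoped k :
    (w k - v k + 2 * \sum_(i < k.+1) v i = (m2 - m1) * \sum_(i < k) u i)%R.
  elim: k => [|k IH]; first by rewrite big_ord1 big_ord0 v0 w0; ring.
  rewrite big_ord_recr/= [in RHS]big_ord_recr/= [in RHS]mulrDr -IH.
  by have := overshoot_eq k; lra.
have := subadditive_le_mean n vD; have := telescoped n; rewrite -natr1.
set U := (\sum_(i < n) u i)%R in renewal_eq *; set V := (\sum_(i < _) v i)%R.
move=> sumV meanV.
have nv_gt0 : (0 < n%:R + v n)%R by rewrite ltr_pwDl ?ltr0n.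
have cleared : ((n%:R + v n) * v n <= (m2 - m1) * U)%R.
  by rewrite -sumV; move: meanV jensen; rewrite expr2; lra.
rewrite lerBrDr ler_pdivlMr// -(ler_pM2r nv_gt0).
have := ler_wpM2l (ltW m1_gt0) cleared.
by rewrite [(m1 * (_ * U))%R]mulrCA -renewal_eq; lra.
Qed.

End subadditive_overshoot.

Section regenerative.
Context {d : measure_display} {T : measurableType d} {R : realType}.
Variable mu : probability (path_space T) R.
Hypothesis mu_regenerative : regenerative mu.

Lemma regenerative_fubini n (D : set (past_space T n))
    (Phi : past_space T n * path_space T -> \bar R) :
  measurable D -> D `<=` renewal_event n ->
  measurable_fun setT Phi -> (forall z, 0 <= Phi z) ->
  \int[mu]_(p in D) Phi (p, shift_seq n p) =
  \int[mu]_(p in D) \int[mu]_q Phi (p, q).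
Proof.
move=> mD Dren mPhi Phi0; have mD' := past_measurable mD.
pose past_law := event_law mu mD' (measurable_past n).
pose joint_law :=
  event_law mu mD'
    (measurable_fun_pair (measurable_past n) (measurable_shift n)).
transitivity (\int[joint_law]_z Phi z); first by rewrite ge0_integral_event_law.
transitivity (\int[past_law \x mu]_z Phi z).
  apply: eq_measure_integral => C mC _; apply/esym.
  apply: product_measure_unique => // A B mA mB.
  transitivity (mu (D `&` A `&` shift_seq n @^-1` B)).
    by rewrite [LHS]event_lawE setIA.
  rewrite mu_regenerative//; [by rewrite -event_lawE|exact: measurableI|].
  by move=> p [/Dren].
rewrite fubini_tonelli1// ge0_integral_event_law//.
- exact: measurable_fun_fubini_tonelli_F.
- by move=> p; exact: integral_ge0.
Qed.

Lemma regenerative_integral n (D : set (past_space T n))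
    (H : path_space T -> \bar R) :
  measurable D -> D `<=` renewal_event n ->
  measurable_fun setT H -> (forall p, 0 <= H p) ->
  \int[mu]_(p in D) H (shift_seq n p) = mu D * \int[mu]_p H p.
Proof.
move=> mD Dren mH H0; have mD' := past_measurable mD.
rewrite (regenerative_fubini (Phi := H \o snd))//; last 2 first.
- exact: measurableT_comp.
- by move=> z; exact: H0.
by rewrite /= integral_cst// muleC.
Qed.

Lemma regenerative_integral_if n (b : past_space T n -> bool)
    (H : path_space T -> \bar R) :
  measurable [set p | b p] -> [set p | b p] `<=` renewal_event n ->
  measurable_fun setT H -> (forall p, 0 <= H p) ->
  \int[mu]_p (if b p then H (shift_seq n p) else 0) =
  mu [set p | b p] * \int[mu]_p H p.
Proof.
move=> mb bren mH H0; rewrite -regenerative_integral// [RHS]integral_mkcond.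
apply: eq_integral => p _.
by rewrite patchE; congr (if _ then _ else _); exact/esym/asboolb.
Qed.

Lemma measurable_fun_restart n (b : past_space T n -> bool)
    (H : path_space T -> \bar R) :
  measurable [set p | b p] -> measurable_fun setT H ->
  measurable_fun setT
    (fun p : path_space T => if b p then H (shift_seq n p) else 0).
Proof.
move=> mb mH; apply: measurable_fun_ifT => //; last first.
  exact: (measurableT_comp mH (measurable_shift n)).
by apply: (measurable_fun_bool true); rewrite setTI;
  exact: (past_measurable mb).
Qed.

Let mrt m :
  measurable_fun setT (fun p : path_space T => @renewal_time R (marks p) m).
Proof. exact: measurable_renewal_time. Qed.

Let mos m :
  measurable_fun setT (fun p : path_space T => @overshoot R (marks p) m).
Proof. exact: measurable_overshoot. Qed.

Let if_ge0 (b : bool) (x : \bar R) : 0 <= x -> 0 <= (if b then x else 0).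
Proof. by case: b. Qed.

Lemma integral_renewal_timeS n :
  \int[mu]_p renewal_time (marks p) n.+1 =
  \int[mu]_p renewal_time (marks p) n +
    mu (renewal_event n) * \int[mu]_p renewal_time (marks p) 1.
Proof.
under eq_integral do rewrite renewal_timeS.
have rt0 m (p : path_space T) : 0 <= @renewal_time R (marks p) m.
  exact: renewal_time_ge0.
rewrite ge0_integralD//; last 2 first.
- by move=> p _; apply: if_ge0; exact: rt0.
- exact: (measurable_fun_restart (measurable_past_renewal_event n) (mrt 1)).
congr (_ + _).
exact: (regenerative_integral_if (measurable_past_renewal_event n) _ (mrt 1)).
Qed.

Lemma integral_renewal_time n :
  \int[mu]_p renewal_time (marks p) n =
  (\sum_(k < n) mu (renewal_event k)) * \int[mu]_p renewal_time (marks p) 1.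
Proof.
elim: n => [|n IH]; first by rewrite big_ord0 mul0e integral0_eq.
rewrite integral_renewal_timeS IH big_ord_recr/= [RHS]ge0_muleDl//.
by apply: sume_ge0 => k _.
Qed.

Lemma integral_overshoot_sqrS n :
  \int[mu]_p (overshoot (marks p) n.+1 ^+ 2) +
    \int[mu]_p overshoot (marks p) n.+1 + \int[mu]_p overshoot (marks p) n +
    mu (renewal_event n) * \int[mu]_p renewal_time (marks p) 1 =
  \int[mu]_p (overshoot (marks p) n ^+ 2) +
    mu (renewal_event n) * \int[mu]_p (renewal_time (marks p) 1 ^+ 2).
Proof.
have os0 m (p : path_space T) : 0 <= @overshoot R (marks p) m.
  exact: overshoot_ge0.
have os20 m (p : path_space T) : 0 <= @overshoot R (marks p) m ^+ 2.
  by rewrite expe_ge0.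
have rt0 (p : path_space T) : 0 <= @renewal_time R (marks p) 1.
  exact: renewal_time_ge0.
have rt20 (p : path_space T) : 0 <= @renewal_time R (marks p) 1 ^+ 2.
  by rewrite expe_ge0.
have mos2 m := emeasurable_funX 2 (mos m).
have mrt2 := emeasurable_funX 2 (mrt 1).
have mif := measurable_fun_restart (measurable_past_renewal_event n) (mrt 1).
have mif2 := measurable_fun_restart (measurable_past_renewal_event n) mrt2.
have mren := measurable_past_renewal_event (T := T) n.
rewrite -(regenerative_integral_if mren (@subset_refl _ _) (mrt 1) rt0).
rewrite -(regenerative_integral_if mren (@subset_refl _ _) mrt2 rt20).
rewrite -!ge0_integralD//.
- by apply: eq_integral => p _; exact: overshoot_sqrS.
all: try by move=> p _; rewrite ?adde_ge0// if_ge0.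
all: by do ?apply: emeasurable_funD.
Qed.

Lemma integral_renewal_timeD n m :
  \int[mu]_p renewal_time (marks p) (n + m) <=
  \int[mu]_p renewal_time (marks p) n + \int[mu]_p renewal_time (marks p) m.
Proof.
have rt0 k (p : path_space T) : 0 <= @renewal_time R (marks p) k.
  exact: renewal_time_ge0.
pose restarted k (p : path_space T) :=
  if first_renewal (marks p) n == Some (n + k)%N
   then @renewal_time R (shift_seq (n + k) (marks p)) m else 0.
have mfirst k : measurable (first_renewal_event n k : set (past_space T k)).
  exact: measurable_first_renewal_event.
have mrestarted k : measurable_fun setT (restarted k).
  exact: (measurable_fun_restart (@mfirst (n + k)%N) (mrt m)).
have restarted0 k p : 0 <= restarted k p by apply: if_ge0; exact: rt0.
have integral_restarted k : \int[mu]_p restarted k p =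
    mu (first_renewal_event n (n + k)) * \int[mu]_p renewal_time (marks p) m.
  apply: (regenerative_integral_if (@mfirst (n + k)%N) _ (mrt m)) => // p.
  by move=> /eqP/first_renewal_Some[].
apply: (@le_trans _ _
    (\int[mu]_p (renewal_time (marks p) n + \sum_(k < m) restarted k p))).
  apply: ge0_le_integral => //; last by move=> p _; exact: renewal_timeD.
  by apply: emeasurable_funD => //; exact: emeasurable_sum.
rewrite ge0_integralD//; last 2 first.
- by move=> p _; exact: sume_ge0.
- exact: emeasurable_sum.
rewrite leeD2l// ge0_integral_sum//.
under eq_bigr do rewrite integral_restarted.
rewrite -ge0_sume_distrl// -[leRHS]mul1e lee_wpmul2r//;
  first exact: integral_ge0.
have mfirst_path k :
  measurable (first_renewal_event n (n + k) : set (path_space T)).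
  exact: measurable_first_renewal_event.
rewrite -(measure_bigsetU_ord mu xpredT
  (F := fun k => first_renewal_event n (n + k)))//.
  by apply: probability_le1; exact: bigsetU_measurable.
apply/trivIsetP => i j _ _; apply: contraNeq => /set0P[p []].
by rewrite /first_renewal_event/= => /eqP-> /eqP[] /addnI/val_inj->.
Qed.

Lemma integral_renewal_time_overshoot n :
  \int[mu]_p renewal_time (marks p) n =
  (n%:R)%:E + \int[mu]_p overshoot (marks p) n.
Proof.
under eq_integral do rewrite renewal_timeE.
rewrite ge0_integralD//; last by move=> p _; exact: overshoot_ge0.
by rewrite integral_probability_cst.
Qed.

Lemma integral_renewal_time_ge n :
  (n%:R)%:E <= \int[mu]_p renewal_time (marks p) n.
Proof.
rewrite integral_renewal_time_overshoot leeDl//.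
by apply: integral_ge0 => p _; exact: overshoot_ge0.
Qed.

Lemma integral_overshoot_jensen n :
  \int[mu]_p overshoot (marks p) n \is a fin_num ->
  \int[mu]_p (overshoot (marks p) n ^+ 2) \is a fin_num ->
  (fine (\int[mu]_p overshoot (marks p) n) ^+ 2 <=
   fine (\int[mu]_p (overshoot (marks p) n ^+ 2)) :> R)%R.
Proof.
move=> os_fin os2_fin; set v := fine (\int[mu]_p overshoot (marks p) n).
have os0 (p : path_space T) : 0 <= @overshoot R (marks p) n.
  exact: overshoot_ge0.
have v0 : (0 <= 2 * v)%R by rewrite mulr_ge0// fine_ge0// integral_ge0.
have mos2 := emeasurable_funX 2 (mos n).
have os20 (p : path_space T) : 0 <= @overshoot R (marks p) n ^+ 2.
  by rewrite expe_ge0.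
have : \int[mu]_p ((2 * v)%:E * overshoot (marks p) n) <=
    \int[mu]_p (overshoot (marks p) n ^+ 2 + (v ^+ 2)%:E).
  apply: ge0_le_integral => //.
  - by move=> p _; rewrite mule_ge0.
  - exact: measurable_funeM.
  - exact: emeasurable_funD.
  - by move=> p _; exact: overshoot_sqr_ge.
rewrite ge0_integralZl// ge0_integralD//;
  last by move=> p _; rewrite lee_fin sqr_ge0.
rewrite integral_probability_cst -(fineK os_fin) -(fineK os2_fin) -/v.
by rewrite -!EFinM -EFinD lee_fin; lra.
Qed.

Section finite_cycle.
Hypothesis cycle_fin : \int[mu]_p renewal_time (marks p) 1 < +oo.

Lemma integral_renewal_time_fin n :
  \int[mu]_p renewal_time (marks p) n \is a fin_num.
Proof.
rewrite integral_renewal_time; apply: fin_numM.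
  apply/sum_fin_numP => k _ _; apply: fin_num_measure.
  exact: measurable_path_renewal_event.
by rewrite ge0_fin_numE//; apply: integral_ge0 => p _; exact: renewal_time_ge0.
Qed.

Lemma no_renewal_null n : mu [set p | first_renewal (marks p) n = None] = 0.
Proof.
have int_rt :
  mu.-integrable setT (fun p : path_space T => @renewal_time R (marks p) n).
  apply/integrableP; split => //.
  under eq_integral do rewrite gee0_abs ?renewal_time_ge0//.
  by rewrite ltey_eq integral_renewal_time_fin.
have [N [mN N0 subN]] := integrable_ae measurableT int_rt.
apply/eqP; rewrite eq_le measure_ge0 andbT -N0 le_measure ?inE//.
  exact: measurable_no_renewal.
by move=> p pN; apply: subN => /= /(_ I);
  rewrite /renewal_time (pN : first_renewal _ _ = _).
Qed.

End finite_cycle.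

Section lorden.
Hypothesis cycle_sqr_fin : \int[mu]_p (renewal_time (marks p) 1 ^+ 2) < +oo.

Lemma integral_cycle_lty : \int[mu]_p renewal_time (marks p) 1 < +oo.
Proof.
have rt0 (p : path_space T) : 0 <= @renewal_time R (marks p) 1.
  exact: renewal_time_ge0.
apply: le_lt_trans cycle_sqr_fin; apply: ge0_le_integral => //.
- exact: (emeasurable_funX 2 (mrt 1)).
- by move=> p _; rewrite expe2 -[leLHS]mule1 lee_pmul//; exact: renewal_time_ge.
Qed.

Lemma integral_overshoot_fin n : \int[mu]_p overshoot (marks p) n \is a fin_num.
Proof.
have := integral_renewal_time_fin integral_cycle_lty n.
by rewrite integral_renewal_time_overshoot fin_numD => /andP[].
Qed.

Lemma integral_overshoot_sqr_fin n :
  \int[mu]_p (overshoot (marks p) n ^+ 2) \is a fin_num.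
Proof.
have os0 k : 0 <= \int[mu]_p overshoot (marks p) k.
  by apply: integral_ge0 => p _; exact: overshoot_ge0.
have rt0 : 0 <= \int[mu]_p renewal_time (marks p) 1.
  by apply: integral_ge0 => p _; exact: renewal_time_ge0.
have os20 k : 0 <= \int[mu]_p (overshoot (marks p) k ^+ 2).
  by apply: integral_ge0 => p _; rewrite expe_ge0// overshoot_ge0.
elim: n => [|n IH];
  first by rewrite integral0_eq// => p _; rewrite overshoot0 expe2 mule0.
rewrite ge0_fin_numE//;
  apply: (@le_lt_trans _ _ (\int[mu]_p (overshoot (marks p) n ^+ 2) +
    mu (renewal_event n) * \int[mu]_p (renewal_time (marks p) 1 ^+ 2))).
  rewrite -integral_overshoot_sqrS; apply: lee_paddr; first exact: mule_ge0.
  by do 2 apply: lee_paddr => //.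
rewrite ltey_eq fin_numD IH fin_numM//.
  by apply: fin_num_measure; exact: measurable_path_renewal_event.
rewrite ge0_fin_numE//.
by apply: integral_ge0 => p _; rewrite expe_ge0// renewal_time_ge0.
Qed.

Lemma lorden n : (0 < n)%N ->
  \int[mu]_p renewal_time (marks p) n <=
  (n%:R + (fine (\int[mu]_p (renewal_time (marks p) 1 ^+ 2)) /
           fine (\int[mu]_p renewal_time (marks p) 1) - 1))%:E.
Proof.
move=> n_gt0.
have os_fin k := integral_overshoot_fin k;
  have os2_fin k := integral_overshoot_sqr_fin k.
have rt_fin k := integral_renewal_time_fin integral_cycle_lty k.
have ren_fin k : mu (renewal_event k) \is a fin_num.
  by apply: fin_num_measure; exact: measurable_path_renewal_event.
have rt2_fin : \int[mu]_p (renewal_time (marks p) 1 ^+ 2) \is a fin_num.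
  rewrite ge0_fin_numE//.
  by apply: integral_ge0 => p _; rewrite expe_ge0// renewal_time_ge0.
rewrite integral_renewal_time_overshoot -(fineK (os_fin n)) -EFinD lee_fin
  lerD2l.
apply: (@overshoot_moments_bound R
  (fun k => fine (\int[mu]_p overshoot (marks p) k))
  (fun k => fine (\int[mu]_p (overshoot (marks p) k ^+ 2)))
  (fun k => fine (mu (renewal_event k)))) => //.
- rewrite fine_gt0// integral_cycle_lty andbT.
  exact: (lt_le_trans _ (integral_renewal_time_ge 1)).
- by rewrite integral0_eq.
- by rewrite integral0_eq// => p _; rewrite overshoot0 expe2 mule0.
- by rewrite fine_ge0//; apply: integral_ge0 => p _; exact: overshoot_ge0.
- apply: EFin_inj; rewrite EFinD fineK// -integral_renewal_time_overshoot.
  rewrite integral_renewal_time muleC EFinM fineK//; congr (_ * _).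
  by rewrite -sumEFin; apply: eq_bigr => i _; rewrite fineK.
- by move=> k; apply: EFin_inj;
    rewrite !EFinD !EFinM !fineK// integral_overshoot_sqrS.
- move=> j k; have := integral_renewal_timeD j k;
    rewrite !integral_renewal_time_overshoot.
  rewrite -(fineK (os_fin j)) -(fineK (os_fin k)) -(fineK (os_fin (j + k)%N)).
  by rewrite -!EFinD lee_fin natrD; lra.
- exact: integral_overshoot_jensen.
Qed.

End lorden.

Section block_sum.
Variable phi : T -> R.
Hypothesis mphi : measurable_fun setT phi.

(** [Xi1] is the case [n = 1]; where no renewal follows [n] the value is 0. *)
Definition block_sum n (p : path_space T) : R :=
  if first_renewal (marks p) n is Some t then (\sum_(i < t) phi (p i).1)%R
  else 0%R.

Definition partial_sum n (p : nat -> T * bool) : R :=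
  (\sum_(i < n) phi (p i).1)%R.

Lemma measurable_partial_sum n :
  measurable_fun setT (partial_sum n : past_space T n -> R).
Proof.
apply: measurable_sum => i; apply: (measurableT_comp mphi).
exact: (@measurable_state _ _ _ n).
Qed.

Lemma measurable_block_sum n : measurable_fun setT (block_sum n).
Proof.
have mfirst t : measurable (first_renewal_event n t : set (path_space T)).
  exact: measurable_first_renewal_event.
apply: (measurable_fun_option mfirst
  (F := fun o p => if o is Some t then (\sum_(i < t) phi (p i).1)%R else 0%R)).
case=> [t|//]; apply: measurable_sum => i; apply: (measurableT_comp mphi).
exact: measurable_path_state.
Qed.

Lemma block_sum_id n (p : path_space T) : renewal_event n p ->
  block_sum n p = partial_sum n p.
Proof. by move=> pn; rewrite /block_sum first_renewal_id. Qed.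

Lemma block_sumS n (p : path_space T) : ~ renewal_event n p ->
  block_sum n.+1 p = block_sum n p.
Proof. by move=> pn; rewrite /block_sum first_renewalS//; exact/negP. Qed.

Lemma block_sumS_sqr_le n (p : path_space T) : renewal_event n p ->
  (block_sum n.+1 p ^+ 2 <=
   (partial_sum n p + block_sum 1 (shift_seq n p)) ^+ 2)%R.
Proof.
move=> pn; rewrite /block_sum -[in leLHS]addn1 (first_renewal_shift 1 pn).
rewrite -[shift_seq n (marks p)]/(marks (shift_seq n p)).
case: first_renewal => [t|] /=; last by rewrite expr0n/= sqr_ge0.
by rewrite big_split_ord.
Qed.

Hypothesis int_cycle : mu.-integrable setT (EFin \o block_sum 1).
Hypothesis cycle_mean0 : \int[mu]_p (block_sum 1 p)%:E = 0.
Hypothesis cycle_sqr_lty : \int[mu]_p (block_sum 1 p ^+ 2)%:E < +oo.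

Lemma renewal_integral_sqr n :
  \int[mu]_(p in renewal_event n)
    ((partial_sum n p + block_sum 1 (shift_seq n p)) ^+ 2)%:E =
  \int[mu]_(p in renewal_event n) (block_sum n p ^+ 2)%:E +
    mu (renewal_event n) * \int[mu]_p (block_sum 1 p ^+ 2)%:E.
Proof.
have mren := measurable_path_renewal_event (T := T) n.
pose Phi (z : past_space T n * path_space T) :=
  ((partial_sum n z.1 + block_sum 1 z.2) ^+ 2)%:E.
rewrite (regenerative_fubini (Phi := Phi) (measurable_past_renewal_event n))//;
  last 2 first.
- apply/measurable_EFinP; apply: measurable_funX; apply: measurable_funD.
  + exact: (measurableT_comp (@measurable_partial_sum n) measurable_fst).
  + exact: (measurableT_comp (measurable_block_sum 1) measurable_snd).
- by move=> z; rewrite lee_fin sqr_ge0.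
under eq_integral do rewrite /Phi/= integral_sqrD_centered//.
rewrite ge0_integralD//.
- rewrite integral_cst// muleC; congr (_ + _).
  by apply: eq_integral => p /set_mem pn; rewrite block_sum_id.
- by move=> p _; rewrite lee_fin sqr_ge0.
- apply/measurable_EFinP; apply: measurable_funTS; apply: measurable_funX.
  exact: (measurableT_comp (@measurable_partial_sum n) (measurable_past n)).
- by move=> p _; apply: integral_ge0 => q _; rewrite lee_fin sqr_ge0.
Qed.

Lemma integral_block_sum_sqrS_le n :
  \int[mu]_p (block_sum n.+1 p ^+ 2)%:E <=
  \int[mu]_p (block_sum n p ^+ 2)%:E +
    mu (renewal_event n) * \int[mu]_p (block_sum 1 p ^+ 2)%:E.
Proof.
have mren : measurable (renewal_event n : set (path_space T)).
  exact: measurable_path_renewal_event.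
have mbs m := measurable_block_sum m.
have mbs2 m : measurable_fun setT (fun p => (block_sum m p ^+ 2)%:E).
  by apply/measurable_EFinP; exact: measurable_funX.
have sqr0 (f : path_space T -> R) p : 0 <= (f p ^+ 2)%:E.
  by rewrite lee_fin sqr_ge0.
have split_renewal m : \int[mu]_p (block_sum m p ^+ 2)%:E =
    \int[mu]_(p in renewal_event n) (block_sum m p ^+ 2)%:E +
    \int[mu]_(p in ~` renewal_event n) (block_sum m p ^+ 2)%:E.
  rewrite -ge0_integral_setU ?setUv//; [exact: measurableC|exact/disj_setPCl].
rewrite (split_renewal n.+1) (split_renewal n) addeAC -renewal_integral_sqr;
  apply: leeD.
  apply: ge0_le_integral => //.
  - exact: measurable_funTS.
  - apply/measurable_EFinP; apply: measurable_funTS; apply: measurable_funX.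
    apply: measurable_funD.
      exact: (measurableT_comp (@measurable_partial_sum n) (measurable_past n)).
    exact: (measurableT_comp (mbs 1%N) (measurable_shift n)).
  - by move=> p pn; rewrite lee_fin block_sumS_sqr_le.
rewrite le_eqVlt; apply/orP; left; apply/eqP.
by apply: eq_integral => p /set_mem pn; rewrite block_sumS.
Qed.

Lemma integral_block_sum_sqr_le_sum n :
  \int[mu]_p (block_sum n p ^+ 2)%:E <=
  (\sum_(k < n) mu (renewal_event k)) * \int[mu]_p (block_sum 1 p ^+ 2)%:E.
Proof.
elim: n => [|n IH].
  rewrite big_ord0 mul0e integral0_eq// => p _.
  by rewrite /block_sum/= big_ord0 expr0n.
apply: (le_trans (integral_block_sum_sqrS_le n)).
rewrite big_ord_recr/= [leRHS]ge0_muleDl//; last by apply: sume_ge0 => k _.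
by rewrite leeD2r.
Qed.

Lemma integral_block_sum_sqr_le_renewal_time n :
  \int[mu]_p renewal_time (marks p) 1 < +oo ->
  \int[mu]_p (block_sum n p ^+ 2)%:E <=
  (fine (\int[mu]_p (block_sum 1 p ^+ 2)%:E) /
   fine (\int[mu]_p renewal_time (marks p) 1))%:E *
    \int[mu]_p renewal_time (marks p) n.
Proof.
move=> rt_lty; apply: (le_trans (integral_block_sum_sqr_le_sum n)).
have rt_fin := integral_renewal_time_fin rt_lty 1.
have bs_fin : \int[mu]_p (block_sum 1 p ^+ 2)%:E \is a fin_num.
  by rewrite ge0_fin_numE//; apply: integral_ge0 => p _;
    rewrite lee_fin sqr_ge0.
have rt_neq0 : fine (\int[mu]_p renewal_time (marks p) 1) != 0%R.
  rewrite gt_eqF// fine_gt0// rt_lty andbT.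
  exact: (lt_le_trans _ (integral_renewal_time_ge 1)).
rewrite (integral_renewal_time n) [leRHS]muleCA
  -[X in _ * (_ * X)](fineK rt_fin).
by rewrite -EFinM divfK// fineK.
Qed.

End block_sum.

End regenerative.

(** * Invariant measures *)

Section invariant_measure.
Context {d : measure_display} {T : measurableType d} {R : realType}.

Lemma measure_diff (m1 : {measure set T -> \bar R})
    (m2 : {finite_measure set T -> \bar R}) :
  (forall A, measurable A -> m1 A <= m2 A) ->
  exists rho : {measure set T -> \bar R},
    forall A, measurable A -> m2 A = rho A + m1 A.
Proof.
move=> m12.
have m1fin A : measurable A -> m1 A \is a fin_num.
  move=> mA; rewrite ge0_fin_numE// (le_lt_trans (m12 _ mA))//.
  by rewrite ltey_eq fin_num_measure.
have m1T : m1 setT < +oo by rewrite ltey_eq m1fin.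
pose diff := cadd (charge_of_finite_measure m2)
  (copp (charge_of_finite_measure (mfrestr measurableT m1T))).
(* [crestr0] makes the charge vanish, hence nonnegative, on nonmeasurable
   sets. *)
pose diff0 := crestr0 diff measurableT.
have diff0E A : measurable A -> diff0 A = m2 A - m1 A.
  move=> mA; rewrite /diff0 /crestr0 mem_set// /crestr setIT.
  by rewrite -[LHS]/(m2 A - m1 (A `&` setT)) setIT.
have diff0_ge0 A : 0 <= diff0 A.
  have [mA|nmA] := pselect (measurable A);
    last by rewrite /diff0 /crestr0 memNset.
  by rewrite diff0E// sube_ge0 ?m12// m1fin.
exists (measure_of_charge diff0 diff0_ge0) => A mA.
by rewrite -[X in _ = X + _]/(diff0 A) diff0E// subeK// m1fin.
Qed.

Variable P : R.-pker T ~> T.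

Lemma kiter_ge0 n x A : 0 <= kiter P n x A.
Proof. by elim: n x => [//|n IH] x /=; exact: integral_ge0. Qed.

Lemma measurable_kiter n A :
  measurable A -> measurable_fun setT (fun x => kiter P n x A).
Proof.
move=> mA; elim: n => [|n IH] /=.
  by under eq_fun do rewrite diracE; apply/measurable_EFinP;
    exact: measurable_indic.
apply: measurable_fun_integral_kernel => //; last by move=> x; exact: kiter_ge0.
by move=> U mU; exact: measurable_kernel.
Qed.

Lemma invariant_measure_null (rho : {measure set T -> \bar R}) (J : set T) :
  measurable J -> (forall A, measurable A -> \int[rho]_x P x A = rho A) ->
  rho J = 0 -> (forall x, exists n, 0 < kiter P n x J) ->
  forall A, measurable A -> rho A = 0.
Proof.
move=> mJ rho_inv rhoJ reachJ.
pose reach n := [set x | 0 < kiter P n x J].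
have mreach n : measurable (reach n).
  rewrite (_ : reach n = setT `&` [set x | 0 < kiter P n x J]);
    last by rewrite setTI.
  by apply: emeasurable_fun_o_infty => //; exact: measurable_kiter.
have reach_null n : rho (reach n) = 0.
  elim: n => [|n IH].
    apply: subset_measure0 rhoJ => // x; rewrite /reach/= diracE.
    by case: (boolP (x \in J)) => [/set_mem//|_]; rewrite ltxx.
  have mP : measurable_fun setT (fun x => P x (reach n)).
    exact: measurable_kernel.
  have : \int[rho]_x `|P x (reach n)| = 0.
    by under eq_integral do rewrite gee0_abs//; rewrite rho_inv.
  move=> /(ae_eq_integral_abs _ measurableT mP)[N [mN N0 subN]].
  apply: subset_measure0 N0 => // x xn; apply: subN => /= /(_ I) Px0.
  have kx0 : kiter P n.+1 x J = 0.
    rewrite /= (ge0_negligible_integral (N := reach n))//; first last.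
    - by move=> y _; exact: kiter_ge0.
    - exact: measurable_kiter.
    rewrite integral0_eq// => y [_ ny].
    by apply/eqP; rewrite eq_le kiter_ge0 andbT leNgt; exact/negP.
  by move: xn; rewrite /reach/= -[X in 0 < X]/(kiter P n.+1 x J) kx0 ltxx.
move=> A mA; apply: (@subset_measure0 _ _ _ rho A setT) => //.
have : rho.-negligible (\bigcup_n reach n).
  apply: negligible_bigcup => n; apply/(negligibleP rho (mreach n));
    exact: reach_null.
rewrite (_ : \bigcup_n reach n = setT);
  first by move/(negligibleP rho measurableT).
by apply/seteqP; split=> // x _; have [n xn] := reachJ x; exists n.
Qed.

End invariant_measure.

(** * The split chain *)

Section split_kernel.
Context {d : measure_display} {T : measurableType d} {R : realType}.
Variables (P : R.-pker T ~> T) (J : set T) (beta : R) (nu : probability T R).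

Definition regen_prob (x : T) : R := (beta * \1_J x)%R.

Definition split_kernel (g : bool) (x : T) (A : set T) : \bar R :=
  if g then (regen_prob x)%:E * nu A
  else (1 - regen_prob x)%:E * Qres P beta J nu x A.

Hypotheses (mJ : measurable J) (beta_gt0 : (0 < beta)%R).
Hypothesis minorization : forall x A, measurable A ->
  (beta * \1_J x)%R%:E * nu A <= P x A.

Lemma regen_prob_ge0 x : (0 <= regen_prob x)%R.
Proof. by rewrite /regen_prob mulr_ge0 ?(ltW beta_gt0)// indicE. Qed.

Lemma regen_prob_le1 x : (regen_prob x <= 1)%R.
Proof.
have := minorization x measurableT.
by rewrite probability_setT mule1 prob_kernel lee_fin.
Qed.

Lemma measurable_regen_prob : measurable_fun setT regen_prob.
Proof. exact: measurable_funM. Qed.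

Lemma integral_regen_prob (m : {measure set T -> \bar R}) :
  \int[m]_x (regen_prob x)%:E = beta%:E * m J.
Proof.
under eq_integral do rewrite /regen_prob EFinM.
rewrite ge0_integralZl_EFin ?(ltW beta_gt0)//; last exact/measurable_EFinP.
by rewrite integral_indic// setIT.
Qed.

Let residual_ge0 x A : measurable A -> 0 <= P x A - (regen_prob x)%:E * nu A.
Proof.
by move=> mA; rewrite sube_ge0;
  [exact: minorization|rewrite fin_numM ?fin_num_measure].
Qed.

Lemma Qres_ge0 x A : measurable A -> 0 <= Qres P beta J nu x A.
Proof.
move=> mA; rewrite /Qres mule_ge0 ?residual_ge0//.
by rewrite lee_fin invr_ge0 subr_ge0 regen_prob_le1.
Qed.

Lemma measurable_Qres A : measurable A ->
  measurable_fun setT (fun x => Qres P beta J nu x A).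
Proof.
move=> mA; apply: emeasurable_funM.
  apply: emeasurable_funB; first exact: measurable_kernel.
  by apply: emeasurable_funM => //; apply/measurable_EFinP;
    exact: measurable_regen_prob.
apply/measurable_EFinP.
rewrite (_ : (fun x => _) = (fun x => if x \in J then (1 - beta)^-1 else 1)%R);
  last first.
  by apply/funext => x; rewrite indicE; case: ifP;
    rewrite ?mulr1// mulr0 subr0 invr1.
apply: measurable_fun_ifT => //; apply: (measurable_fun_bool true).
by rewrite setTI (_ : _ @^-1` _ = J)//; apply/seteqP; split=> x;
  [exact: set_mem|exact: mem_set].
Qed.

Lemma split_kernel_ge0 g x A : measurable A -> 0 <= split_kernel g x A.
Proof.
move=> mA; case: g; rewrite /split_kernel mule_ge0 ?lee_fin ?regen_prob_ge0//.
  by rewrite subr_ge0 regen_prob_le1.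
exact: Qres_ge0.
Qed.

Lemma measurable_split_kernel g A : measurable A ->
  measurable_fun setT (fun x => split_kernel g x A).
Proof.
move=> mA; case: g; apply: emeasurable_funM => //.
- by apply/measurable_EFinP; exact: measurable_regen_prob.
- apply/measurable_EFinP; apply: measurable_funB => //;
    exact: measurable_regen_prob.
- exact: measurable_Qres.
Qed.

Lemma split_kernelE x A : measurable A ->
  split_kernel true x A + split_kernel false x A = P x A.
Proof.
move=> mA; have nuA_fin : (regen_prob x)%:E * nu A \is a fin_num.
  by rewrite fin_numM ?fin_num_measure.
rewrite /split_kernel /Qres -/(regen_prob x).
have [b1|b1] := eqVneq (regen_prob x) 1%R; last first.
  by rewrite muleCA -EFinM divff ?mule1 1?addeC ?subeK// subr_eq0 eq_sym.
(* The junk value [0^-1 = 0] is harmless: here the residual has total mass 0. *)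
rewrite b1 subrr mul0e adde0 mul1e; apply/esym/eqP.
have residual_eq0 : P x setT - (regen_prob x)%:E * nu setT = 0.
  by rewrite prob_kernel probability_setT b1 mule1 subee.
have mCA : measurable (~` A) by exact: measurableC.
have residualD : (P x A - nu A) + (P x (~` A) - nu (~` A)) = 0.
  rewrite -residual_eq0 b1 mul1e -(setUv A) !measureU ?setICr//.
  by rewrite addeACA fin_num_oppeD ?fin_num_measure.
have := residual_ge0 x mA; have := residual_ge0 x mCA;
  rewrite b1 !mul1e => CA0 A0.
move/eqP: residualD; rewrite padde_eq0// => /andP[+ _].
rewrite sube_eq ?add0e// ?fin_num_adde_defl ?fin_num_measure//.
rewrite ge0_fin_numE//; apply: (@le_lt_trans _ _ (P x setT));
  last by rewrite prob_kernel ltry.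
by rewrite le_measure ?inE.
Qed.

End split_kernel.

Section split_chain.
Context {d d' : measure_display} {T : measurableType d} {Om : measurableType d'}
  {R : realType}.
Variables (P : R.-pker T ~> T) (J : set T) (beta : R) (nu : probability T R).
Hypotheses (mJ : measurable J) (beta_gt0 : (0 < beta)%R).
Hypothesis minorization : forall x A, measurable A ->
  (beta * \1_J x)%R%:E * nu A <= P x A.
Variables (Pr : probability Om R) (Xs : nat -> Om -> T) (G : nat -> Om -> bool).
Hypothesis chain : is_split_chain Pr Xs G P beta J nu.

Local Notation b := (regen_prob J beta).

Let b_ge0 x : (0 <= b x)%R. Proof. exact: regen_prob_ge0. Qed.
Let b_le1 x : (b x <= 1)%R. Proof. exact: regen_prob_le1 minorization x. Qed.
Let mb : measurable_fun setT b. Proof. exact: measurable_regen_prob. Qed.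

Definition traj (w : Om) : nat -> T * bool := fun i => (Xs i w, G i w).

Lemma measurable_chain_state n : measurable_fun setT (Xs n).
Proof. by case: chain. Qed.

Lemma measurable_chain_mark n : measurable_fun setT (G n).
Proof.
have [_ mG _ _ _] := chain.
by apply: (measurable_fun_bool true); rewrite setTI; exact: mG.
Qed.

Lemma measurable_traj (N : set nat) :
  measurable_fun setT (traj : Om -> cyl_space T N).
Proof.
by apply: measurable_fun_path => i;
  [exact: measurable_chain_state|exact: measurable_chain_mark].
Qed.

Let mXs n C : measurable C -> measurable (Xs n @^-1` C).
Proof.
by move=> mC; rewrite -[X in measurable X]setTI; exact: measurable_chain_state.
Qed.

Lemma measurable_cyl n A B :
  (forall i, measurable (A i)) -> measurable (cyl Xs G n A B).
Proof.
move=> mA; rewrite -[X in measurable X]setTI.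
exact: (@measurable_traj setT measurableT _
  (@measurable_cylinder _ T n A B mA)).
Qed.

Lemma cylS n A B :
  cyl Xs G n.+1 A B = cyl Xs G n A B `&` [set w | A n (Xs n w) /\ B n (G n w)].
Proof. by rewrite -[LHS]/(traj @^-1` cylinder n.+1 A B) cylinderS. Qed.

Section mark_given_past.
Variables (n : nat) (A : nat -> set T) (B : nat -> set bool).
Hypothesis mA : forall i, measurable (A i).
Local Notation E := (cyl Xs G n A B).

Let mE : measurable E. Proof. exact: measurable_cyl. Qed.
Let mG : measurable [set w | G n w]. Proof. by case: chain. Qed.
Let mX := measurable_chain_state n.
Let mbE : measurable_fun setT (EFin \o b). Proof. exact/measurable_EFinP. Qed.
Let mbcE : measurable_fun setT (fun x => (1 - b x)%:E).
Proof. by apply/measurable_EFinP; exact: measurable_funB. Qed.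

Lemma prob_mark_true C : measurable C ->
  Pr (E `&` [set w | G n w] `&` Xs n @^-1` C) =
  \int[Pr]_(w in E `&` Xs n @^-1` C) (b (Xs n w))%:E.
Proof.
move=> mC; have [_ _ _ mark_law _] := chain; rewrite -mark_law//.
by congr (Pr _); apply/seteqP; split=> w /= => [[[]]|[? []]].
Qed.

Lemma prob_mark_false C : measurable C ->
  Pr (E `&` ~` [set w | G n w] `&` Xs n @^-1` C) =
  \int[Pr]_(w in E `&` Xs n @^-1` C) (1 - b (Xs n w))%:E.
Proof.
move=> mC; have mEC : measurable (E `&` Xs n @^-1` C).
  by apply: measurableI => //; exact: mXs.
have mbX : measurable_fun setT (fun w => b (Xs n w)).
  exact: measurableT_comp mb (measurable_chain_state n).
have total : Pr (E `&` Xs n @^-1` C) =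
    \int[Pr]_(w in E `&` Xs n @^-1` C) (b (Xs n w))%:E +
    \int[Pr]_(w in E `&` Xs n @^-1` C) (1 - b (Xs n w))%:E.
  rewrite -ge0_integralD//.
  - under eq_integral do rewrite -EFinD addrC subrK.
    by rewrite integral_cst// mul1e.
  - by move=> w _; rewrite lee_fin.
  - by apply: measurable_funTS; apply/measurable_EFinP.
  - by move=> w _; rewrite lee_fin subr_ge0.
  - by apply: measurable_funTS; apply/measurable_EFinP; exact: measurable_funB.
apply: (addIe (x := \int[Pr]_(w in E `&` Xs n @^-1` C) (b (Xs n w))%:E)).
  by rewrite -prob_mark_true// fin_num_measure//; do !apply: measurableI => //;
    exact: mXs.
rewrite addeC [RHS]addeC -total -prob_mark_true// -measureU.
- by congr (Pr _); rewrite -setIUl -setIUr setUv setIT.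
- by do !apply: measurableI => //; exact: mXs.
- by do !apply: measurableI => //; [exact: measurableC|exact: mXs].
- by apply/seteqP; split=> w // [[[_ ?] _] [[_ ?] _]].
Qed.

Lemma integral_mark_true (h : T -> \bar R) :
  measurable_fun setT h -> (forall x, 0 <= h x) ->
  \int[Pr]_(w in E `&` [set w | G n w]) h (Xs n w) =
  \int[Pr]_(w in E) (h (Xs n w) * (b (Xs n w))%:E).
Proof.
move=> mh h0; have mEG := measurableI _ _ mE mG.
apply: (ge0_integral_event_law_density (g := EFin \o b)) => //.
exact: prob_mark_true.
Qed.

Lemma integral_mark_false (h : T -> \bar R) :
  measurable_fun setT h -> (forall x, 0 <= h x) ->
  \int[Pr]_(w in E `&` ~` [set w | G n w]) h (Xs n w) =
  \int[Pr]_(w in E) (h (Xs n w) * (1 - b (Xs n w))%:E).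
Proof.
move=> mh h0; have mEGc := measurableI _ _ mE (measurableC mG).
apply: (ge0_integral_event_law_density (g := fun x => (1 - b x)%:E)) => //.
  by move=> x; rewrite lee_fin subr_ge0.
exact: prob_mark_false.
Qed.

Lemma integral_mark (h : bool -> T -> \bar R) :
  (forall g, measurable_fun setT (h g)) -> (forall g x, 0 <= h g x) ->
  \int[Pr]_(w in E) h (G n w) (Xs n w) =
  \int[Pr]_(w in E) (h true (Xs n w) * (b (Xs n w))%:E +
                     h false (Xs n w) * (1 - b (Xs n w))%:E).
Proof.
move=> mh h0; have mhX g : measurable_fun setT (fun w => h g (Xs n w)).
  exact: measurableT_comp (mh g) mX.
have mEG := measurableI _ _ mE mG;
  have mEGc := measurableI _ _ mE (measurableC mG).
rewrite ge0_integralD//; last 4 first.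
- by move=> w _; rewrite mule_ge0// lee_fin.
- apply: measurable_funTS; apply: emeasurable_funM => //.
  exact: measurableT_comp mbE mX.
- by move=> w _; rewrite mule_ge0// lee_fin subr_ge0.
- apply: measurable_funTS; apply: emeasurable_funM => //.
  exact: measurableT_comp mbcE mX.
rewrite -integral_mark_true// -integral_mark_false//.
rewrite -{1}[E]setIT -(setUv [set w | G n w]) setIUr ge0_integral_setU//;
  first last.
- by apply/disj_setPS => w [[_ ?] [_ ?]].
- apply: measurable_funTS.
  rewrite (_ : (fun w => _) =
      (fun w => if G n w then h true (Xs n w) else h false (Xs n w))).
    by apply: measurable_fun_ifT => //; exact: measurable_chain_mark.
  by apply/funext => w; case: (G n w).
congr (_ + _); apply: eq_integral => w /set_mem[_ /=]; first by move=> ->.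
by move=> /negP/negbTE ->.
Qed.

End mark_given_past.

Lemma split_chain_step n A B C : (forall i, measurable (A i)) -> measurable C ->
  Pr (cyl Xs G n.+1 A B `&` Xs n.+1 @^-1` C) =
  \int[Pr]_(w in cyl Xs G n A B `&` Xs n @^-1` A n)
    \sum_(g : bool | g \in B n) split_kernel P J beta nu g (Xs n w) C.
Proof.
move=> mA mC; have [_ _ _ _ ->//] := chain.
pose jump g x := if g then nu C else Qres P beta J nu x C.
pose h g := if g \in B n then jump g \_ (A n) else cst 0.
have jump0 g x : 0 <= jump g x by case: g => //; exact: Qres_ge0.
have mjump g : measurable_fun setT (jump g).
  by case: g; [exact: measurable_cst|exact: (measurable_Qres P beta nu mJ mC)].
have h0 g x : 0 <= h g x by rewrite /h; case: ifP => // _; exact: erestrict_ge0.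
have mh g : measurable_fun setT (h g).
  rewrite /h; case: ifP => // _.
  by apply/(measurable_restrictT _ (mA n)); exact: measurable_funTS.
transitivity (\int[Pr]_(w in cyl Xs G n A B) h (G n w) (Xs n w)).
  rewrite cylS integral_mkcondr; apply: eq_integral => w _.
  rewrite patchE /h; case: ifPn => [/set_mem[An Bn]|nAB].
    by rewrite mem_set// patchE mem_set.
  case: ifPn => // /set_mem Bn; rewrite patchE; case: ifPn => // /set_mem An.
  by rewrite mem_set in nAB.
rewrite integral_mark// integral_mkcondr; apply: eq_integral => w _.
have hE g : h g (Xs n w) =
    if g \in B n then (if Xs n w \in A n then jump g (Xs n w) else 0) else 0.
  by rewrite /h; case: ifP => // _; rewrite patchE.
pose step x := \sum_(g : bool | g \in B n) split_kernel P J beta nu g x C.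
have -> : ((step \o Xs n) \_ (Xs n @^-1` A n)) w =
    if Xs n w \in A n then step (Xs n w) else 0.
  by rewrite patchE; congr (if _ then _ else _); apply/idP/idP => /set_mem An;
    exact: mem_set.
rewrite !hE /step; case: (_ \in A n); last by rewrite !if_same !mul0e adde0.
by rewrite big_mkcond big_bool/=; congr (_ + _); case: ifP => _;
  rewrite ?mul0e// muleC.
Qed.

Lemma prob_at_renewal n A B C : (forall i, measurable (A i)) -> measurable C ->
  cylinder n A B `<=` renewal_event n ->
  Pr (cyl Xs G n A B `&` Xs n @^-1` C) = Pr (cyl Xs G n A B) * nu C.
Proof.
move=> mA mC; have [_ _ X0_law _ jump_law] := chain; case: n => [|n] cyl_ren.
  rewrite -[cyl _ _ _ _ _]/(traj @^-1` cylinder 0 A B) cylinder0 preimage_setT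
    setTI.
  by rewrite X0_law// probability_setT mul1e.
rewrite jump_law// (eq_integral (fun=> nu C)); last first.
  by move=> w /set_mem /(cyl_ren (traj w));
    rewrite /renewal_event/= /renewal/= /marks/= => ->.
by rewrite integral_cst; [exact: muleC|exact: measurable_cyl].
Qed.

Lemma prob_cyl_splice n m A B A' B' C :
  (forall i, measurable (A i)) -> (forall i, measurable (A' i)) ->
  measurable C ->
  cylinder n A B `<=` renewal_event n ->
  Pr (cyl Xs G (n + m) (splice n A A') (splice n B B')
      `&` Xs (n + m)%N @^-1` C) =
  Pr (cyl Xs G n A B) * Pr (cyl Xs G m A' B' `&` Xs m @^-1` C).
Proof.
move=> mA mA' mC cyl_ren; elim: m C mC => [|m IH] C mC.
  have -> : cyl Xs G (n + 0) (splice n A A') (splice n B B') = cyl Xs G n A B.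
    rewrite -[LHS]/(traj @^-1` cylinder _ _ _) cylinder_splice cylinder0.
    by rewrite preimage_setI preimage_setT setIT.
  rewrite addn0 prob_at_renewal//; congr (_ * _).
  rewrite -[cyl _ _ _ _ _]/(traj @^-1` cylinder 0 A' B') cylinder0
    preimage_setT setTI.
  by have [_ _ -> ] := chain.
have mAA' := measurable_splice n mA mA'.
have cE : (fine (Pr (cyl Xs G n A B)))%:E = Pr (cyl Xs G n A B).
  by rewrite fineK// fin_num_measure//; exact: measurable_cyl.
rewrite addnS !split_chain_step// !splice_addn.
rewrite -cE.
pose step x := \sum_(g : bool | g \in B' m) split_kernel P J beta nu g x C.
apply: (ge0_integral_eq_event_law (f := step)) => //.
- by apply: measurableI; [exact: measurable_cyl|exact: mXs].
- by apply: measurableI; [exact: measurable_cyl|exact: mXs].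
- exact: measurable_chain_state.
- exact: measurable_chain_state.
- exact: fine_ge0.
- by move=> D mD; rewrite cE -!setIA;
    exact: (IH _ (measurableI _ _ (mA' m) mD)).
- rewrite /step; under eq_fun do rewrite big_mkcond/=.
  apply: emeasurable_sum => g; case: (g \in B' m) => //.
  exact: (measurable_split_kernel P beta nu mJ g mC).
- by move=> x; apply: sume_ge0 => g _; exact: split_kernel_ge0.
Qed.

Lemma renewal_cylinder n (A : nat -> set T) B :
  exists B', renewal_event n `&` cylinder n A B = cylinder n A B'.
Proof.
case: n => [|n]; first by exists B; rewrite cylinder0 setIT; apply/seteqP;
  split.
exists (fun i => if i == n then B i `&` [set true] else B i).
apply/seteqP; split=> p /=.
  move=> [pn pAB] i /[dup] lt_in /pAB[pA pB]; split=> //.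
  by case: eqP => [ni|//]; rewrite ni in pB *; split=> //; exact: pn.
move=> pAB; split.
  by have [_] := pAB n (ltnSn n); rewrite eqxx => -[_ pn]; exact: pn.
by move=> i /pAB[pA]; case: eqP => // _ [].
Qed.

Definition traj_law : probability (path_space T) R :=
  distribution Pr (mfun_Sub (mem_set (@measurable_traj setT))
    : {RV Pr >-> path_space T}).

Lemma traj_law_regenerative : regenerative traj_law.
Proof.
move=> n D H mD Dren mH.
have mren : measurable (renewal_event n : set (path_space T)).
  exact: measurable_path_renewal_event.
rewrite -(setIidr Dren).
apply: (@event_indep_gen _ _ _ (path_space T) (past_space T n) (path_space T) R
  (cylinders T [set n]) (cylinders T setT) traj_law traj_law
  (renewal_event n) id (shift_seq n)
  _ _ _ _ _ _ _ _ _ _ D H mD mH) => //.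
- by apply: setI_closed_cylinders => i j -> ->; rewrite maxnn.
- exact: (@cylindersT _ _ _ n).
- exact: setI_closed_cylinders.
- exact: (@cylindersT _ _ _ 0%N).
- exact: measurable_past.
- exact: measurable_shift.
move=> _ _ [_ [A [B [-> mA ->]]]] [m [A' [B' [_ mA' ->]]]].
have [B'' /[dup] cylB'' ->] := renewal_cylinder n A B.
have := @prob_cyl_splice n m A B'' A' B' setT mA mA' measurableT.
rewrite preimage_setT !setIT -cylinder_splice; apply.
by rewrite -cylB''; exact: subIsetl.
Qed.

Lemma ge0_integral_traj_law (F : path_space T -> \bar R) :
  measurable_fun setT F -> (forall p, 0 <= F p) ->
  \int[traj_law]_p F p = \int[Pr]_w F (traj w).
Proof. by move=> mF F0; rewrite ge0_integral_distribution. Qed.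

Lemma measurable_no_renewal_traj n :
  measurable [set w | first_renewal (G^~ w) n = None].
Proof.
by have := @measurable_traj setT measurableT _ (@measurable_no_renewal _ T n);
  rewrite setTI.
Qed.

Lemma measurable_block_sum_traj (phi : T -> R) n : measurable_fun setT phi ->
  measurable_fun setT (fun w => block_sum phi n (traj w)).
Proof.
move=> mphi.
exact: measurableT_comp (measurable_block_sum mphi n) (@measurable_traj setT).
Qed.

Lemma measurable_Xi1 (phi : T -> R) : measurable_fun setT phi ->
  measurable_fun setT (Xi1 phi Xs G).
Proof. by move=> mphi; exact: (measurable_block_sum_traj 1 mphi). Qed.

(** * Kac's formula *)

Definition alive (n : nat) : set Om :=
  cyl Xs G n (fun=> setT) (fun=> [set false]).

Let malive n : measurable (alive n). Proof. exact: measurable_cyl. Qed.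

Definition cycle_law (n : nat) : {measure set T -> \bar R} :=
  event_law Pr (malive n) (measurable_chain_state n).

Definition occupation : {measure set T -> \bar R} := mseries cycle_law 0.

Lemma alive_first_renewal w t n :
  first_renewal (G^~ w) 1 = Some t -> alive n w <-> (n < t)%N.
Proof.
case: t => [|t] /first_renewal_Some[// _ Gt tmin]; split=> [nalive|nt j jn].
  rewrite ltnS leqNgt; apply/negP => tn.
  by have [_] := nalive t tn; rewrite /= (Gt : G t w = true).
split=> //=; apply/negbTE; apply: (tmin j.+1).
by rewrite /=; exact: leq_trans jn nt.
Qed.

Lemma first_renewal_alive n :
  [set w | first_renewal (G^~ w) 1 == Some n.+1] = alive n `&` [set w | G n w].
Proof.
apply/seteqP; split=> w /= => [/eqP firstn|[nalive Gn]].
  split; first exact/(alive_first_renewal _ firstn).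
  by move/first_renewal_Some : firstn => [_].
apply/eqP/first_renewal_Some; split=> // -[//|j] /= jn.
by rewrite /renewal/=; have [_ ->] := nalive j jn.
Qed.

Lemma cycle_lawE n A : cycle_law n A = Pr (alive n `&` Xs n @^-1` A).
Proof. exact: event_lawE. Qed.

Lemma cycle_law0 A : measurable A -> cycle_law 0 A = nu A.
Proof.
move=> mA; have [_ _ <- // _ _] := chain; rewrite cycle_lawE.
by congr (Pr _); apply/seteqP; split=> w // [].
Qed.

Lemma cycle_lawS n A : measurable A ->
  cycle_law n.+1 A = \int[cycle_law n]_x split_kernel P J beta nu false x A.
Proof.
move=> mA; rewrite cycle_lawE split_chain_step// preimage_setT setIT.
rewrite ge0_integral_event_law; first last.
- by move=> x; exact: split_kernel_ge0.
- exact: (measurable_split_kernel P beta nu mJ false mA).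
apply: eq_integral => w _; rewrite (big_pred1 false)// => g.
by apply/idP/eqP => [/set_mem|->]//; exact: mem_set.
Qed.

Lemma prob_first_renewal n :
  Pr [set w | first_renewal (G^~ w) 1 == Some n.+1] = beta%:E * cycle_law n J.
Proof.
rewrite first_renewal_alive -[X in Pr X]setIT -(preimage_setT (Xs n))
  prob_mark_true//.
rewrite preimage_setT setIT -(integral_regen_prob mJ beta_gt0).
by rewrite ge0_integral_event_law//; exact/measurable_EFinP.
Qed.

Lemma integral_kernel_split (m : {measure set T -> \bar R}) A : measurable A ->
  \int[m]_x P x A =
  \int[m]_x split_kernel P J beta nu false x A + beta%:E * m J * nu A.
Proof.
move=> mA.
have sk0 g x : 0 <= split_kernel P J beta nu g x A by exact: split_kernel_ge0.
have msk g : measurable_fun setT (fun x => split_kernel P J beta nu g x A).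
  exact: (measurable_split_kernel P beta nu mJ g mA).
under eq_integral => x _ do rewrite -(split_kernelE minorization x mA).
rewrite ge0_integralD// addeC; congr (_ + _).
rewrite ge0_integralZr//; last 2 first.
- exact/measurable_EFinP.
- by move=> x _; rewrite lee_fin.
by congr (_ * _); exact: integral_regen_prob.
Qed.

Lemma occupationE A : occupation A = \sum_(0 <= n <oo) cycle_law n A.
Proof. by []. Qed.

Lemma occupation_split A : measurable A ->
  occupation A = nu A + \int[occupation]_x split_kernel P J beta nu false x A.
Proof.
move=> mA; rewrite occupationE nneseries_recl// cycle_law0//; congr (_ + _).
rewrite -nneseries_addn// /occupation ge0_integral_measure_series//;
  last 2 first.
- by move=> x _; exact: split_kernel_ge0.
- exact: (measurable_split_kernel P beta nu mJ false mA).
by apply: eq_eseriesr => n _; rewrite addn1 cycle_lawS.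
Qed.

Section finite_cycle_occupation.
Hypothesis finite_cycle : Pr [set w | first_renewal (G^~ w) 1 = None] = 0.

Lemma occupation_J : beta%:E * occupation J = 1.
Proof.
pose first n := [set w | first_renewal (G^~ w) 1 == Some n.+1].
have mfirst n : measurable (first n).
  by rewrite /first first_renewal_alive; apply: measurableI => //;
    have [] := chain.
have mU : measurable (\bigcup_n first n) by exact: bigcup_measurable.
have firstC : ~` (\bigcup_n first n) = [set w | first_renewal (G^~ w) 1 = None].
  apply/seteqP; split=> w /= => [nofirst|noneE [n _]];
    last by rewrite /first/= noneE.
  case wE : (first_renewal (G^~ w) 1) => [[|t]|//].
    by move/first_renewal_Some : wE => [].
  by exfalso; apply: nofirst; exists t => //=; rewrite /first/= wE.
have PrU : Pr (\bigcup_n first n) = 1.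
  rewrite -[bigcup _ _]setCK probability_setC; last exact: measurableC.
  by rewrite firstC finite_cycle sube0.
rewrite occupationE -nneseriesZl ?(ltW beta_gt0)//.
rewrite (eq_eseriesr (g := Pr \o first));
  last by move=> n _; rewrite /= prob_first_renewal.
rewrite -(measure_semi_bigcup Pr)//.
apply/trivIsetP => i j _ _; apply: contraNeq => /set0P[w []].
by rewrite /first/= => /eqP-> /eqP[->].
Qed.

Lemma occupation_invariant A : measurable A ->
  \int[occupation]_x P x A = occupation A.
Proof.
move=> mA.
by rewrite integral_kernel_split// occupation_J mul1e addeC -occupation_split.
Qed.

Lemma Xi1_nneseries (phi : T -> R) w t : (forall x, 0 <= phi x)%R ->
  first_renewal (G^~ w) 1 = Some t ->
  (Xi1 phi Xs G w)%:E =
  \sum_(0 <= n <oo) ((fun w => (phi (Xs n w))%:E) \_ (alive n)) w.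
Proof.
move=> phi0 wE; rewrite (nneseries_split _ t)//=; last first.
  by move=> n _; apply: erestrict_ge0 => ?; rewrite lee_fin.
rewrite add0n big_mkord [X in _ + X]eseries0 ?adde0; last first.
  by move=> n tn _; rewrite patchE memNset// => /(alive_first_renewal _ wE);
    rewrite ltnNge tn.
rewrite /Xi1 -[regen _ 1]/(first_renewal (G^~ w) 1) wE -sumEFin.
apply: eq_bigr => n _; rewrite patchE mem_set//.
exact/(alive_first_renewal _ wE).
Qed.

Lemma occupation_integral (phi : T -> R) :
  measurable_fun setT phi -> (forall x, 0 <= phi x)%R ->
  \int[occupation]_x (phi x)%:E = \int[Pr]_w (Xi1 phi Xs G w)%:E.
Proof.
move=> mphi phi0;
  have mphiE : measurable_fun setT (EFin \o phi) by exact/measurable_EFinP.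
pose visit n := (fun w => (phi (Xs n w))%:E) \_ (alive n).
have mvisit n : measurable_fun setT (visit n).
  apply/(measurable_restrictT _ (malive n)); apply: measurable_funTS.
  exact: (measurableT_comp mphiE (measurable_chain_state n)).
have visit0 n w : 0 <= visit n w by apply: erestrict_ge0 => ?; rewrite lee_fin.
rewrite /occupation ge0_integral_measure_series//;
  last by move=> x _; rewrite lee_fin.
transitivity (\sum_(0 <= n <oo) \int[Pr]_w visit n w).
  apply: eq_eseriesr => n _; rewrite ge0_integral_event_law//.
  by rewrite integral_mkcond.
rewrite -integral_nneseries//.
apply: ge0_ae_eq_integral => //.
- exact: ge0_emeasurable_sum.
- by apply/measurable_EFinP; exact: measurable_Xi1.
- by move=> w _; exact: nneseries_ge0.
- by move=> w _; rewrite lee_fin /Xi1; case: regen => // t; exact: sumr_ge0.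
exists [set w | first_renewal (G^~ w) 1 = None]; split => //.
  exact: measurable_no_renewal_traj.
move=> w; rewrite /setC /mkset; apply: contra_notP.
case wE : (first_renewal (G^~ w) 1) => [t|//] _ _.
by rewrite (Xi1_nneseries phi0 wE).
Qed.

Variable pi : probability T R.
Hypotheses (irreducible : pi_irreducible pi P) (piJ : 0 < pi J).
Hypothesis stationary : forall A, measurable A -> \int[pi]_x P x A = pi A.

Definition regen_rate : R := (beta * fine (pi J))%R.

Let regen_rateE : regen_rate%:E = beta%:E * pi J.
Proof. by rewrite EFinM fineK// fin_num_measure. Qed.

Let regen_rate_gt0 : (0 < regen_rate)%R.
Proof. by rewrite -lte_fin regen_rateE mule_gt0. Qed.

Let regen_rate_ge0 : (0 <= regen_rate)%R. Proof. exact: ltW. Qed.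

Lemma msum_cycle_law_le N A :
  measurable A -> regen_rate%:E * msum cycle_law N A <= pi A.
Proof.
elim: N A => [|N IH] A mA; first by rewrite /msum big_ord0 mule0.
have sk0 x : 0 <= split_kernel P J beta nu false x A by exact: split_kernel_ge0.
have msk : measurable_fun setT (fun x => split_kernel P J beta nu false x A).
  exact: (measurable_split_kernel P beta nu mJ false mA).
rewrite /msum big_ord_recl/= ge0_muleDr//; last exact: sume_ge0.
rewrite -(stationary mA) integral_kernel_split// -regen_rateE [leRHS]addeC
  cycle_law0// leeD2l//.
under eq_bigr do rewrite cycle_lawS//.
rewrite -(ge0_integral_measure_sum cycle_law measurableT
  (fun x _ => sk0 x) msk).
rewrite -[regen_rate]/((NngNum regen_rate_ge0)%:num) -ge0_integral_mscale//.
exact: ge0_le_measure_integral.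
Qed.

Lemma occupation_le A : measurable A -> regen_rate%:E * occupation A <= pi A.
Proof.
move=> mA; rewrite occupationE -nneseriesZl//; apply: lime_le.
  by apply: is_cvg_nneseries => n _ _; rewrite mule_ge0.
apply: nearW => N; rewrite -ge0_sume_distrr// big_mkord.
exact: msum_cycle_law_le.
Qed.

(** [pi] minus the scaled occupation measure is invariant and does not charge
    [J], so it vanishes. *)
Lemma stationary_occupation A :
  measurable A -> pi A = regen_rate%:E * occupation A.
Proof.
pose lam : {measure set T -> \bar R} :=
  mscale (NngNum regen_rate_ge0) occupation.
have [rho rhoE] := measure_diff (m1 := lam) (m2 := pi) occupation_le.
have lam_fin B : measurable B -> lam B \is a fin_num.
  move=> mB; rewrite ge0_fin_numE// (le_lt_trans (occupation_le mB))//.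
  by rewrite ltey_eq fin_num_measure.
have lam_inv B : measurable B -> \int[lam]_x P x B = lam B.
  move=> mB; rewrite ge0_integral_mscale//; last exact: measurable_kernel.
  by rewrite occupation_invariant.
have rho_inv B : measurable B -> \int[rho]_x P x B = rho B.
  move=> mB.
  have mP : measurable_fun setT (fun x => P x B) by exact: measurable_kernel.
  apply: (addIe (lam_fin _ mB)); transitivity (pi B); last exact: rhoE.
  rewrite /= -(lam_inv _ mB) -ge0_integral_measure_add// -(stationary mB).
  by apply: eq_measure_integral => C mC _; rewrite [LHS]measure_addE;
    exact/esym/rhoE.
have rhoJ : rho J = 0.
  apply: (addIe (lam_fin _ mJ)); rewrite /= add0e; transitivity (pi J);
    first exact/esym/rhoE.
  by rewrite -[RHS]/(regen_rate%:E * occupation J) regen_rateE muleAC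
    occupation_J mul1e.
move=> mA; apply: (eq_trans (rhoE _ mA));
  rewrite (invariant_measure_null mJ rho_inv rhoJ)// ?add0e// => x.
by have [n xn] := irreducible mJ piJ x; exists n.+1.
Qed.

Lemma kac_ge0 (phi : T -> R) :
  measurable_fun setT phi -> (forall x, 0 <= phi x)%R ->
  \int[pi]_x (phi x)%:E = regen_rate%:E * \int[Pr]_w (Xi1 phi Xs G w)%:E.
Proof.
move=> mphi phi0; rewrite -occupation_integral//.
rewrite [LHS](eq_measure_integral (mscale (NngNum regen_rate_ge0) occupation));
  last first.
  by move=> A mA _; exact: stationary_occupation.
rewrite ge0_integral_mscale//; first exact/measurable_EFinP.
by move=> x _; rewrite lee_fin.
Qed.

Lemma Xi1_ge0 (phi : T -> R) w :
  (forall x, 0 <= phi x)%R -> (0 <= Xi1 phi Xs G w)%R.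
Proof. by move=> phi0; rewrite /Xi1; case: regen => // t; exact: sumr_ge0. Qed.

Lemma Xi1B (phi psi : T -> R) w :
  Xi1 (phi - psi)%R Xs G w = (Xi1 phi Xs G w - Xi1 psi Xs G w)%R.
Proof. by rewrite /Xi1; case: regen => [t|]; rewrite ?subr0// -sumrB. Qed.

Lemma kac_ge0_integrable (phi : T -> R) : (forall x, 0 <= phi x)%R ->
  pi.-integrable setT (EFin \o phi) ->
  Pr.-integrable setT (EFin \o Xi1 phi Xs G).
Proof.
move=> phi0 int_phi; have mphi : measurable_fun setT phi.
  exact/measurable_EFinP/measurable_int/int_phi.
apply/integrableP; split;
  first by apply/measurable_EFinP; exact: measurable_Xi1.
under eq_integral do rewrite gee0_abs ?lee_fin ?Xi1_ge0//.
have := integrable_fin_num measurableT int_phi; rewrite kac_ge0//.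
by case: (\int[Pr]_w _) => [r||]//; rewrite ?ltry// mulry gtr0_sg// mul1e.
Qed.

Lemma kac (phi : T -> R) : pi.-integrable setT (EFin \o phi) ->
  Pr.-integrable setT (EFin \o Xi1 phi Xs G) /\
  \int[pi]_x (phi x)%:E = regen_rate%:E * \int[Pr]_w (Xi1 phi Xs G w)%:E.
Proof.
move=> int_phi; have mphi : measurable_fun setT phi.
  exact/measurable_EFinP/measurable_int/int_phi.
have int_pos := integrable_funrpos measurableT int_phi.
have int_neg := integrable_funrneg measurableT int_phi.
have Xint_pos := kac_ge0_integrable (funrpos_ge0 phi) int_pos.
have Xint_neg := kac_ge0_integrable (funrneg_ge0 phi) int_neg.
have XiE w :
  (EFin \o Xi1 phi Xs G) w = (Xi1 phi^\+ Xs G w)%:E - (Xi1 phi^\- Xs G w)%:E.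
  by rewrite -EFinB -Xi1B funrposBneg.
have phiE x : (phi x)%:E = (phi^\+ x)%:E - (phi^\- x)%:E.
  by rewrite -EFinB -[in LHS](funrposBneg phi).
rewrite (funext XiE : EFin \o _ = _); split; first exact: integrableB.
rewrite (eq_integral _ _ (fun x _ => phiE x)) integralB_EFin//.
rewrite [in RHS](eq_integral _ _ (fun w _ => XiE w)) integralB_EFin//.
have Xneg_fin := integrable_fin_num measurableT Xint_neg.
rewrite muleBr ?fin_num_adde_defl ?fin_numN//; congr (_ - _); apply: kac_ge0.
- exact: measurable_funrpos.
- exact: funrpos_ge0.
- exact: measurable_funrneg.
- exact: funrneg_ge0.
Qed.

Lemma Xi1_mean0 (phi : T -> R) : pi.-integrable setT (EFin \o phi) ->
  \int[pi]_x (phi x)%:E = 0 -> \int[Pr]_w (Xi1 phi Xs G w)%:E = 0.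
Proof.
move=> /kac[_ ->] /eqP; rewrite mule_eq0 eqe gt_eqF//= => /eqP.
exact.
Qed.

End finite_cycle_occupation.

Lemma integral_renewal_time_traj n :
  \int[traj_law]_p renewal_time (marks p) n = \int[Pr]_w renewal_time (G^~ w) n.
Proof.
rewrite ge0_integral_traj_law//; first exact: measurable_renewal_time.
by move=> p; exact: renewal_time_ge0.
Qed.

Lemma integral_TRbar_traj n : (0 < n)%N ->
  \int[traj_law]_p renewal_time (marks p) n = \int[Pr]_w TRbar (G^~ w) n.
Proof.
move=> n0; rewrite integral_renewal_time_traj.
by apply: eq_integral => w _; rewrite TRbar_renewal_time.
Qed.

Lemma integral_cycle_traj :
  \int[traj_law]_p renewal_time (marks p) 1 = \int[Pr]_w Tbar (G^~ w) 1.
Proof. exact: integral_renewal_time_traj. Qed.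

Lemma integral_cycle_sqr_traj :
  \int[traj_law]_p (renewal_time (marks p) 1 ^+ 2) =
  \int[Pr]_w (Tbar (G^~ w) 1 ^+ 2).
Proof.
rewrite ge0_integral_traj_law//;
  first exact: emeasurable_funX (measurable_renewal_time 1).
by move=> p; rewrite expe_ge0// renewal_time_ge0.
Qed.

Lemma integral_block_sum_sqr_traj (phi : T -> R) n : measurable_fun setT phi ->
  \int[traj_law]_p (block_sum phi n p ^+ 2)%:E =
  \int[Pr]_w (block_sum phi n (traj w) ^+ 2)%:E.
Proof.
move=> mphi; rewrite ge0_integral_traj_law//.
  by apply/measurable_EFinP; apply: measurable_funX;
    exact: measurable_block_sum.
by move=> p; rewrite lee_fin sqr_ge0.
Qed.

Lemma integral_Xi1_sqr_traj (phi : T -> R) : measurable_fun setT phi ->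
  \int[traj_law]_p (block_sum phi 1 p ^+ 2)%:E =
  \int[Pr]_w (Xi1 phi Xs G w ^+ 2)%:E.
Proof. exact: integral_block_sum_sqr_traj. Qed.

Lemma integral_TRbar_le n :
  (0 < n)%N -> \int[Pr]_w (Tbar (G^~ w) 1 ^+ 2) < +oo ->
  \int[Pr]_w TRbar (G^~ w) n <=
  (n%:R + (fine (\int[Pr]_w (Tbar (G^~ w) 1 ^+ 2)) /
           fine (\int[Pr]_w Tbar (G^~ w) 1) - 1))%:E.
Proof.
move=> n_gt0.
rewrite -integral_cycle_sqr_traj -integral_cycle_traj => cycle_sqr_lty.
by rewrite -integral_TRbar_traj//; exact: (lorden traj_law_regenerative).
Qed.

Section estimator.
Variables (f : T -> R) (theta : R) (n : nat).
Hypotheses (mf : measurable_fun setT f) (n_gt0 : (0 < n)%N).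

Local Notation fbar := (fun x => (f x - theta)%R).

Lemma measurable_theta_hat : measurable_fun setT (theta_hat f Xs G n).
Proof.
have mfirst t : measurable (first_renewal_event n t : set (path_space T)).
  exact: measurable_first_renewal_event.
pose F o (p : path_space T) :=
  (if o is Some t then (\sum_(i < t) f (p i).1) / t%:R else 0)%R.
rewrite (_ : theta_hat f Xs G n =
    (fun p => F (first_renewal (marks p) n) p) \o traj).
  apply: (measurableT_comp (measurable_fun_option mfirst _)
    (@measurable_traj setT)).
  case=> [t|]; last exact: measurable_cst.
  apply: measurable_funM => //; apply: measurable_sum => i.
  by apply: (measurableT_comp mf); exact: measurable_path_state.
by apply/funext => w; rewrite /theta_hat TR_first_renewal.
Qed.

Lemma theta_hat_error_sqr_le w : first_renewal (G^~ w) n <> None ->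
  ((theta_hat f Xs G n w - theta) ^+ 2 <=
   n%:R ^- 2 * block_sum fbar n (traj w) ^+ 2)%R.
Proof.
rewrite /theta_hat TR_first_renewal// /block_sum -[marks _]/(G^~ w).
case nE : (first_renewal _ n) => [t|//] _;
  have [nt _ _] := (first_renewal_Some _ _ _).1 nE.
have t_gt0 : (0 < t%:R :> R)%R by rewrite ltr0n (leq_trans n_gt0 nt).
have nR_gt0 : (0 < n%:R :> R)%R by rewrite ltr0n.
have -> : ((\sum_(i < t) f (Xs i w)) / t%:R - theta =
    (\sum_(i < t) fbar (Xs i w)) / t%:R)%R.
  rewrite sumrB sumr_const card_ord mulrBl; congr (_ - _)%R.
  by rewrite -[(theta *+ t)%R]mulr_natr mulfK// gt_eqF.
rewrite exprMn mulrC exprVn ler_wpM2r ?sqr_ge0//.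
by rewrite lef_pV2 ?posrE ?exprn_gt0// lerXn2r ?nnegrE ?ler_nat.
Qed.

Lemma integral_theta_hat_error_le_block_sum : \int[Pr]_w Tbar (G^~ w) 1 < +oo ->
  \int[Pr]_w ((theta_hat f Xs G n w - theta) ^+ 2)%:E <=
  (n%:R ^- 2)%:E * \int[Pr]_w (block_sum fbar n (traj w) ^+ 2)%:E.
Proof.
rewrite -integral_cycle_traj => cycle_lty.
have mfbar : measurable_fun setT fbar by exact: measurable_funB.
have mbs2 : measurable_fun setT (fun w => (block_sum fbar n (traj w) ^+ 2)%:E).
  apply/measurable_EFinP; apply: measurable_funX.
  exact: measurable_block_sum_traj.
rewrite -ge0_integralZl_EFin//; last by move=> w _; rewrite lee_fin sqr_ge0.
apply: ae_ge0_le_integral => //.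
- by move=> w _; rewrite lee_fin sqr_ge0.
- apply/measurable_EFinP; apply: measurable_funX; apply: measurable_funB => //.
  exact: measurable_theta_hat.
- by move=> w _; rewrite -EFinM lee_fin mulr_ge0 ?sqr_ge0// invr_ge0 sqr_ge0.
- exact: measurable_funeM.
exists [set w | first_renewal (G^~ w) n = None]; split.
- exact: measurable_no_renewal_traj.
- exact: (no_renewal_null traj_law_regenerative cycle_lty n).
by move=> w; apply: contra_notP => nN _;
  rewrite -EFinM lee_fin theta_hat_error_sqr_le.
Qed.

End estimator.

Section mean_square_error.
Variable pi : probability T R.
Hypotheses (irreducible : pi_irreducible pi P) (piJ : 0 < pi J).
Hypothesis stationary : forall A, measurable A -> \int[pi]_x P x A = pi A.
Variables (f : T -> R) (theta : R).
Hypotheses (mf : measurable_fun setT f)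
  (int_f : pi.-integrable setT (EFin \o f)).
Hypothesis f_mean : \int[pi]_x (f x)%:E = theta%:E.

Local Notation fbar := (fun x => (f x - theta)%R).

Lemma mean_square_error_le n : (0 < n)%N ->
  \int[Pr]_w (Xi1 fbar Xs G w ^+ 2)%:E < +oo ->
  \int[Pr]_w (Tbar (G^~ w) 1 ^+ 2) < +oo ->
  \int[Pr]_w ((theta_hat f Xs G n w - theta) ^+ 2)%:E <=
  (fine (\int[Pr]_w (Xi1 fbar Xs G w ^+ 2)%:E) /
    fine (\int[Pr]_w Tbar (G^~ w) 1) / n%:R ^+ 2)%:E *
    \int[Pr]_w TRbar (G^~ w) n.
Proof.
move=> n_gt0 Xi_sqr_lty; rewrite -integral_cycle_sqr_traj => cycle_sqr_lty.
have cycle_lty := integral_cycle_lty cycle_sqr_lty.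
have mfbar : measurable_fun setT fbar by exact: measurable_funB.
have int_theta : pi.-integrable setT (fun=> theta%:E).
  exact: finite_measure_integrable_cst.
have int_fbar : pi.-integrable setT (EFin \o fbar).
  rewrite (_ : EFin \o fbar = (EFin \o f) \- (fun=> theta%:E));
    first exact: integrableB.
  by apply/funext => x /=; rewrite EFinB.
have fbar_mean0 : \int[pi]_x (fbar x)%:E = 0.
  under eq_integral do rewrite EFinB.
  by rewrite integralB// f_mean integral_probability_cst subee.
have finite_cycle : Pr [set w | first_renewal (G^~ w) 1 = None] = 0.
  exact: (no_renewal_null traj_law_regenerative cycle_lty 1).
have [int_Xi _] := kac finite_cycle irreducible piJ stationary int_fbar.
have Xi_mean0 :=
  Xi1_mean0 finite_cycle irreducible piJ stationary int_fbar fbar_mean0.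
have int_cycle : traj_law.-integrable setT (EFin \o block_sum fbar 1).
  apply: integrable_pushforward => //.
  by apply/measurable_EFinP; exact: measurable_block_sum.
have cycle_mean0 : \int[traj_law]_p (block_sum fbar 1 p)%:E = 0.
  rewrite -Xi_mean0 integral_distribution//.
  by apply/measurable_EFinP; exact: measurable_block_sum.
apply: (le_trans (integral_theta_hat_error_le_block_sum theta mf n_gt0 _)).
  by rewrite -integral_cycle_traj.
rewrite [in leRHS]mulrC EFinM -muleA lee_wpmul2l ?lee_fin ?invr_ge0 ?sqr_ge0//.
rewrite -integral_block_sum_sqr_traj// -integral_TRbar_traj//
  -integral_cycle_traj.
rewrite -integral_Xi1_sqr_traj// in Xi_sqr_lty *.
exact: (integral_block_sum_sqr_le_renewal_time traj_law_regenerative).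
Qed.

End mean_square_error.

End split_chain.

Theorem theorem3p1 (R : realType)
  (M : completePseudoMetricType R) (HM : polish_space M)
  (pi : probability (borel_type M) R)
  (P : R.-pker (borel_type M) ~> (borel_type M))
  (Hirr : pi_irreducible pi P)
  (Hstat : forall A, measurable A -> \int[pi]_x P x A = pi A)
  (J : set (borel_type M)) (mJ : measurable J) (piJ : 0 < pi J)
  (beta : R) (beta_gt0 : (0 < beta)%R)
  (nu : probability (borel_type M) R)
  (Hminor : forall x A, measurable A ->
     (beta * \1_J x)%R%:E * nu A <= P x A)
  (d' : measure_display) (Om : measurableType d') (Pr : probability Om R)
  (Xs : nat -> Om -> borel_type M) (G : nat -> Om -> bool)
  (Hsplit : is_split_chain Pr Xs G P beta J nu)
  (f : borel_type M -> R) (mf : measurable_fun setT f)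
  (intf : pi.-integrable setT (EFin \o f))
  (n : nat) (n_ge1 : (1 <= n)%N) :
  let theta := fine (\int[pi]_x (f x)%:E) in
  let fbar := fun x => (f x - theta)%R in
  let EXi2 := \int[Pr]_w ((Xi1 fbar Xs G w) ^+ 2)%:E in
  let Etau := \int[Pr]_w Tbar (G^~ w) 1 in
  let Etau2 := \int[Pr]_w (Tbar (G^~ w) 1) ^+ 2 in
  let ETR := \int[Pr]_w TRbar (G^~ w) n in
  EXi2 < +oo -> Etau2 < +oo ->
  let sigma2 := (fine EXi2 / fine Etau)%R in
  let n0 := (fine Etau2 / fine Etau - 1)%R in
  \int[Pr]_w ((theta_hat f Xs G n w - theta) ^+ 2)%:E
    <= (sigma2 / n%:R ^+ 2)%R%:E * ETR
  /\ ETR <= (n%:R + n0)%R%:E.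
Proof.
move=> theta fbar EXi2 Etau Etau2 ETR EXi2_lty Etau2_lty sigma2 n0.
have f_mean : \int[pi]_x (f x)%:E = theta%:E.
  by rewrite fineK// integrable_fin_num.
split; last exact: (integral_TRbar_le mJ beta_gt0 Hminor Hsplit).
exact: (mean_square_error_le mJ beta_gt0 Hminor Hsplit Hirr piJ Hstat mf intf
  f_mean).
Qed.
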